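(* With $x_{jk}$, $\tau_0$ as defined in the context, put $$t_0 = x_{21},$$ $$t_1 =5^4x_{21}\left((6z-1)x_{21}+5(11z-1)x_{22}+25(6z-1)x_{23}+125(z-1)x_{24}\right),$$ $$t_2 = 5^4x_{21}^2 \left((2z-7)x_{21}+15(z-1)x_{22}+25(z-1)x_{23}\right),$$ $$t_3 = 5^4x_{21}^3\left((z-6)x_{21}+5(z-1)x_{22} \right),$$ $$t_4 = zx_{21}^5,$$ $$t_5 =5^5(z-1)x_{21}^2\left(x_{12}x_{21}-x_{11}x_{22} \right),$$ $$t_6 = 5^5(z-1)x_{21}\left(3(x_{12}x_{21}-x_{11}x_{22})+ 5(x_{13}x_{21}-x_{11}x_{23}) \right).$$ Then there are holomorphic functions $h_0,\ldots,h_6$ defined in some neighborhood of $0\in\mathbb{C}$ such that (for $z$ near $0$) $$t_k=\left(\frac{2\pi i}{5}\right)^{d_k}h_k(e^{2\pi i \tau_0}),\qquad k=0,1,\ldots,6,$$ where $d_k:=3(k+1)$ for $k=0,1,2,3,4$, $d_5:=11$, $d_6:=8$. Moreover, the $t_k$'s satisfy the following system of ordinary differential equations, with $\dot{*}:=\frac{\partial *}{\partial\tau_0}$: $$\dot t_0=\tfrac{1}{t_5}(6\cdot 5^4t_0^5+t_0t_3-5^4t_4),$$ $$\dot t_1=\tfrac{1}{t_5}(-5^8t_0^6+5^5t_0^4t_1+5^8t_0t_4+t_1t_3),$$ $$\dot t_2=\tfrac{1}{t_5}(-3\cdot 5^9t_0^7-5^4t_0^5t_1+2\cdot 5^5t_0^4t_2+3\cdot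 5^9 t_0^2t_4+5^4t_1t_4+2t_2t_3),$$ $$\dot t_3=\tfrac{1}{t_5}(-5^{10}t_0^8-5^4t_0^5t_2+3\cdot 5^5t_0^4t_3+5^{10}t_0^3t_4+5^4t_2t_4+3t_3^2),$$ $$\dot t_4=\tfrac{1}{t_5}(5^6t_0^4t_4+5t_3t_4),$$ $$\dot t_5=\tfrac{1}{t_5}(-5^4t_0^5t_6+3\cdot 5^5t_0^4t_5+2t_3t_5+5^4t_4t_6),$$ $$\dot t_6=\tfrac{1}{t_5}(3\cdot 5^5t_0^4t_6-5^5t_0^3t_5-2t_2t_5+3t_3t_6).$$
   Context: Let $\theta=z\frac{\partial}{\partial z}$ and consider the linear differential equation $$\left(\theta^4-z(\theta+\tfrac{1}{5})(\theta+\tfrac{2}{5})(\theta+\tfrac{3}{5})(\theta+\tfrac{4}{5})\right)\psi=0.$$ A basis of its (multivalued, near $z=0$) solutions is $$\psi_k(z)=\frac{1}{k!}\left.\frac{\partial^k}{\partial \epsilon^k}\left(5^{-5\epsilon}F(\epsilon,z)\right)\right|_{\epsilon=0},\quad k=0,1,2,3,$$ $$F(\epsilon,z):=\sum_{n=0}^\infty \frac{(\frac{1}{5}+\epsilon)_n(\frac{2}{5}+\epsilon)_n(\frac{3}{5}+\epsilon)_n (\frac{4}{5}+\epsilon)_n }{(1+\epsilon)_n^4}z^{\epsilon+n},$$ where $(a)_n:=a(a+1)\cdots(a+n-1)$ for $n>0$ and $(a)_0:=1$. Define $$\begin{pmatrix} x_{11}\\ x_{21}\\ x_{31}\\ x_{41}\end{pmatrix}=\begin{pmatrix}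 0 &0&1&0\\ 0&0&0&1\\ 0&5&\frac{5}{2}&-\frac{25}{12}\\ -5&0&-\frac{25}{12}&200\frac{\zeta(3)}{(2\pi i)^3}\end{pmatrix}\begin{pmatrix}\frac{1}{5^4}\psi_3\\ \frac{2\pi i}{5^4}\psi_2\\ \frac{(2\pi i)^2}{5^4}\psi_1\\ \frac{(2\pi i)^3}{5^4}\psi_0\end{pmatrix},$$ $x_{jk}:=\theta^{k-1}x_{j1}$ for $j,k=1,2,3,4$, and $\tau_0:=\frac{x_{11}}{x_{21}}$. Here $i=\sqrt{-1}$. The function $\tau_0$ is used as a local coordinate in place of $z$ (near $z=0$), so $\partial/\partial\tau_0$ means $(\theta\tau_0)^{-1}\theta$; functions multivalued in $z$ are considered on any common branch. *)

(* Defs.v *)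
From HB Require Import structures.
From mathcomp Require Import all_boot all_order all_algebra.
From mathcomp.real_closed Require Export complex.
From mathcomp Require Import all_classical all_reals all_analysis.

Set Implicit Arguments.
Unset Strict Implicit.
Unset Printing Implicit Defensive.

Import Order.TTheory GRing.Theory Num.Theory.
Import numFieldNormedType.Exports.

Local Open Scope complex_scope.
Local Open Scope ring_scope.
Local Open Scope classical_set_scope.

(* [R[i]] packaged as a [numClosedFieldType]: this is how it inherits the
   topology and the normed-module structure over itself, so that [f^`()] and
   [derivable f z 1] are the complex derivative and complex differentiability. *)
Definition Cplx (R : realType) : numClosedFieldType := R[i].

Definition ofR (R : realType) (a : R) : Cplx R := a%:C.

Definition cexp (R : realType) (z : Cplx R) : Cplx R :=
  (expR (complex.Re z) * cos (complex.Im z)) +i* (expR (complex.Re z) * sin (complex.Im z)).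

Definition twopii (R : realType) : Cplx R := ofR (2 * pi) * 'i%C.

Definition zeta3 (R : realType) : R :=
  limn (series (fun n : nat => (n.+1%:R ^+ 3)^-1 : R)).

Definition theta (R : realType) (f : Cplx R -> Cplx R) (z : Cplx R) : Cplx R :=
  z * (f^`())%classic z.

Definition poch (R : realType) (a : Cplx R) (n : nat) : Cplx R :=
  \prod_(i < n) (a + i%:R).

(* [L] is a branch of the logarithm on the open set [U] (so [0] is not in [U]).
   All multivalued functions below take such an [L] as parameter, and
   [z ^ a] stands for [cexp (a * L z)]. *)
Definition log_branch (R : realType) (U : set (Cplx R)) (L : Cplx R -> Cplx R) :
    Prop :=
  [/\ open U, {in U, continuous L} & forall z, U z -> cexp (L z) = z].

Definition hyperF (R : realType) (L : Cplx R -> Cplx R) (eps z : Cplx R) :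
    Cplx R :=
  limn (series (fun n : nat =>
    poch (1 / 5 + eps) n * poch (2 / 5 + eps) n *
    poch (3 / 5 + eps) n * poch (4 / 5 + eps) n / poch (1 + eps) n ^+ 4 *
    cexp ((eps + n%:R) * L z) : Cplx R)).

Definition psi (R : realType) (L : Cplx R -> Cplx R) (k : nat) (z : Cplx R) :
    Cplx R :=
  (k`!%:R)^-1 *
  (fun eps : Cplx R =>
     cexp (- 5 * eps * ofR (ln 5)) * hyperF L eps z)^`(k)%classic 0.

Definition period_mx (R : realType) : 'M[Cplx R]_4 :=
  \matrix_(i < 4, j < 4) nth 0 (nth [::] [::
    [:: 0;   0; 1;           0];
    [:: 0;   0; 0;           1];
    [:: 0;   5; 5 / 2;       - (25 / 12)];
    [:: - 5; 0; - (25 / 12); 200 * (ofR (zeta3 R) / twopii R ^+ 3)]] i) j.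

Definition psi_col (R : realType) (L : Cplx R -> Cplx R) (z : Cplx R) :
    'cV[Cplx R]_4 :=
  \col_(i < 4) (twopii R ^+ i / 5 ^+ 4 * psi L (3 - i) z).

(* Both indices start at 1, i.e. [xx L j k] is [x_{jk}] for [1 <= j, k <= 4]. *)
Definition xx (R : realType) (L : Cplx R -> Cplx R) (j k : nat) :
    Cplx R -> Cplx R :=
  iter k.-1 (@theta R)
    (fun z => (period_mx R *m psi_col L z) (inord j.-1) 0).

Definition tau0 (R : realType) (L : Cplx R -> Cplx R) (z : Cplx R) : Cplx R :=
  xx L 1 1 z / xx L 2 1 z.

(* The derivative [d/d tau0] of a function of [z]. *)
Definition dtau (R : realType) (L : Cplx R -> Cplx R) (f : Cplx R -> Cplx R)
    (z : Cplx R) : Cplx R :=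
  theta f z / theta (tau0 L) z.

Definition tfun (R : realType) (L : Cplx R -> Cplx R) (k : nat) (z : Cplx R) :
    Cplx R :=
  let x11 := xx L 1 1 z in let x12 := xx L 1 2 z in let x13 := xx L 1 3 z in
  let x21 := xx L 2 1 z in let x22 := xx L 2 2 z in let x23 := xx L 2 3 z in
  let x24 := xx L 2 4 z in
  match k with
  | 0%N => x21
  | 1%N => 5 ^+ 4 * x21 * ((6 * z - 1) * x21 + 5 * (11 * z - 1) * x22
           + 25 * (6 * z - 1) * x23 + 125 * (z - 1) * x24)
  | 2%N => 5 ^+ 4 * x21 ^+ 2 * ((2 * z - 7) * x21 + 15 * (z - 1) * x22
           + 25 * (z - 1) * x23)
  | 3%N => 5 ^+ 4 * x21 ^+ 3 * ((z - 6) * x21 + 5 * (z - 1) * x22)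
  | 4%N => z * x21 ^+ 5
  | 5%N => 5 ^+ 5 * (z - 1) * x21 ^+ 2 * (x12 * x21 - x11 * x22)
  | 6%N => 5 ^+ 5 * (z - 1) * x21 * (3 * (x12 * x21 - x11 * x22)
           + 5 * (x13 * x21 - x11 * x23))
  | _ => 0
  end.

Definition deg (k : nat) : nat :=
  match k with 5%N => 11%N | 6%N => 8%N | _ => (3 * (k + 1))%N end.

(* Main.v *)
(* In the local coordinate [z] each [t_k] is a polynomial in [z], in the
   [theta]-derivatives of [psi_0] and in two Wronskians of [psi_0] and [psi_1];
   the logarithm cancels in these, so every [t_k] is a power series in [z].
   Moreover [q = exp (2 pi i tau_0)] equals [z * G z] with [G] holomorphic and
   [G 0 != 0], so [z] is a holomorphic function of [q] near [0] and [h_k] is [t_k]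
   (rescaled) composed with it.
   The differential equations are rational identities modulo the equation
   satisfied by [psi_0], a Pluecker relation between the Wronskians, and the
   vanishing on [(psi_0, psi_1)] of the alternating form preserved by the
   self-dual equation; this last form is constant because its [theta] vanishes,
   and it is [0] at [z = 0].
   The second period [psi_1] is a derivative in [epsilon] of a power series,
   computed term by term from quadratic remainder bounds on the coefficients. *)

Require Import Defs.
From HB Require Import structures.
From mathcomp Require Import all_boot all_order all_algebra.
From mathcomp Require Import all_classical all_reals all_analysis.
From mathcomp Require Import ring lra.

Set Implicit Arguments.
Unset Strict Implicit.
Unset Printing Implicit Defensive.

Import Order.TTheory GRing.Theory Num.Theory.
Import numFieldNormedType.Exports.

Local Open Scope ring_scope.
Local Open Scope classical_set_scope.

(** * The modulus and epsilon-delta forms of limits and derivatives *)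

(** The system closes because the [theta]-derivatives of the seven quantities [z], [x_21], ...,
    [x_24], [W_01], [W_02] are functions of the same seven. The delicate one is
    [theta W_02 = W_03 + W_12], which brings in two further Wronskians: the Pluecker relation gives
    [W_12], the alternating form gives [W_03 - W_12]. The set [V] and the [h_k] have to be fixed
    before the branch [L]. Since [theta L = 1], the branch enters [theta^k psi_1] only as the
    summand [L] times [theta^k psi_0]; antisymmetry removes it from the Wronskians, and
    [cexp (L z) = z] removes it from [q]. The weights [d_k] count factors [2 pi i]: 3 for each
    [x_2j] and 2 + 3 = 5 for each Wronskian, so that [t_5] gets 6 + 5 = 11 and [t_6] gets 3 + 5 = 8.
    Differentiation in [epsilon] under the infinite sum needs remainder constants that grow only
    polynomially in [n]. They do, because each factor [(k / 5 + e + n) / (1 + e + n)] of a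
    coefficient has modulus at most 1 for [|e| <= 1 / 10]. *)

Section ComplexAnalysis.
Variable R : realType.
Local Notation C := (Cplx R).
Implicit Types (z w h d : C) (f g : C -> C).

(** The norm of [Cplx R] takes its values in [Cplx R] itself. Its real part moves all estimates into
    the ordered field [R], where linear arithmetic applies. *)
Definition cabs z : R := complex.Re `|z|.

Lemma normE z : `|z| = ofR (cabs z).
Proof. by rewrite /cabs /ofR normc_def. Qed.

Lemma cabs_ge0 z : 0 <= cabs z.
Proof. by rewrite -lecR; have := normr_ge0 z; rewrite normE. Qed.

Lemma ofRM (a b : R) : ofR (a * b) = ofR a * ofR b.
Proof. exact: rmorphM. Qed.

Lemma ofRD (a b : R) : ofR (a + b) = ofR a + ofR b.
Proof. exact: rmorphD. Qed.

Lemma cabs0 : cabs 0 = 0.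
Proof. by rewrite /cabs normr0. Qed.

Lemma cabs1 : cabs 1 = 1.
Proof. by rewrite /cabs normr1. Qed.

Lemma cabsN z : cabs (- z) = cabs z.
Proof. by rewrite /cabs normrN. Qed.

Lemma cabsM z w : cabs (z * w) = cabs z * cabs w.
Proof. by apply: complexI; rewrite -[LHS]normE normrM !normE -ofRM. Qed.

Lemma cabsD z w : cabs (z + w) <= cabs z + cabs w.
Proof. by rewrite -lecR; have := ler_normD z w; rewrite !normE -ofRD. Qed.

Lemma cabsB z w : cabs (z - w) <= cabs z + cabs w.
Proof. by rewrite -(cabsN w) cabsD. Qed.

Lemma cabs_distC z w : cabs (z - w) = cabs (w - z).
Proof. by rewrite -cabsN opprB. Qed.

Lemma cabs_eq0 z : (cabs z == 0) = (z == 0).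
Proof.
apply/eqP/eqP => [z0|->]; last exact: cabs0.
by apply/eqP; rewrite -normr_eq0 normE z0.
Qed.

Lemma cabs_gt0 z : (0 < cabs z) = (z != 0).
Proof. by rewrite lt_def cabs_ge0 andbT cabs_eq0. Qed.

Lemma cabsX z n : cabs (z ^+ n) = cabs z ^+ n.
Proof. by elim: n => [|n IH]; rewrite ?expr0 ?cabs1// !exprS cabsM IH. Qed.

Lemma cabsV z : cabs z^-1 = (cabs z)^-1.
Proof.
have [->|z0] := eqVneq z 0; first by rewrite invr0 cabs0 invr0.
apply: (@mulfI _ (cabs z)); first by rewrite cabs_eq0.
by rewrite -cabsM !divff ?cabs1// cabs_eq0.
Qed.

Lemma cabs_ofR (a : R) : cabs (ofR a) = `|a|.
Proof. by rewrite /cabs normc_def /= expr0n /= addr0 sqrtr_sqr. Qed.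

Lemma ofR_nat n : ofR n%:R = n%:R :> C.
Proof. exact: rmorph_nat. Qed.

Lemma cabs_nat n : cabs n%:R = n%:R.
Proof. by rewrite -ofR_nat cabs_ofR ger0_norm ?ler0n. Qed.

Lemma cabs_le_ReIm z : cabs z <= `|complex.Re z| + `|complex.Im z|.
Proof.
rewrite {1}(complexE z) (le_trans (cabsD _ _))// cabsM -!/(ofR _) !cabs_ofR.
suff -> : cabs ('i%C : C) = 1 by rewrite mul1r.
by rewrite /cabs normc_def /= expr0n expr1n add0r sqrtr1.
Qed.

Lemma Re_le_cabs z : `|complex.Re z| <= cabs z.
Proof. by rewrite -lecR; have := normc_ge_Re z; rewrite normE. Qed.

Lemma Im_le_cabs z : `|complex.Im z| <= cabs z.
Proof.
rewrite /cabs normc_def /= -sqrtr_sqr ler_wsqrtr//.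
by rewrite lerDr sqr_ge0.
Qed.

Lemma cabs_sub_ge z w : cabs z - cabs w <= cabs (z - w).
Proof. by rewrite lerBlDr -{1}(subrK w z) cabsD. Qed.

Lemma nearCP (z0 : C) (P : C -> Prop) :
  (\forall z \near z0, P z) <->
  exists2 r : R, 0 < r & forall z, cabs (z - z0) < r -> P z.
Proof.
split.
- move=> /nbhs_ballP[/= e e0 eP]; exists (complex.Re e).
    by move: e0; rewrite ltcE /= => /andP[].
  move=> z zr; apply: eP; rewrite /ball /= /ball_ distrC normE ltcE /=.
  move: e0; rewrite ltcE /= => /andP[/eqP -> _].
  by rewrite eqxx.
- move=> [r r0 rP]; apply/nbhs_ballP; exists (ofR r); rewrite /= ?ltcR//.
  move=> z; rewrite /ball /= /ball_ distrC normE => zr; apply: rP.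
  by rewrite -ltcR.
Qed.

Lemma cvgCP (T : Type) (F : set_system T) {FF : Filter F} (f : T -> C) (l : C) :
  f @ F --> l <->
  forall e : R, 0 < e -> \forall x \near F, cabs (f x - l) < e.
Proof.
split=> [fl e e0|H].
  suff : nbhs l [set y | cabs (y - l) < e] by move/fl.
  by apply/nearCP; exists e.
by move=> A /nearCP[r r0 rA]; apply: filterS (H _ r0) => x /rA.
Qed.

(** With the difference quotient multiplied out, the bound includes [h = 0], so compositions need no
    case distinction on a vanishing increment. *)
Lemma is_deriveCP f z d : is_derive z 1 f d <->
  forall e : R, 0 < e -> exists2 r : R, 0 < r &
    forall h, cabs h < r -> cabs (f (z + h) - f z - h * d) <= e * cabs h.
Proof.
have -> : is_derive z 1 f d <->
    (fun h : C => h^-1 *: (f (h + z) - f z)) @ 0^' --> d.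
  rewrite (_ : (fun h : C => _) =
      (fun h => h^-1 *: ((f \o shift z) (h *: 1) - f z))); last first.
    by apply/funext => h /=; rewrite [_%:A]mulr1.
  split => [[df <-]|cf]; first exact: df.
  split; [by apply/cvg_ex; exists d | exact: cvg_lim].
rewrite cvgCP; split => H e e0.
- have /nearCP[r r0 rH] := H e e0; exists r => // h hr.
  have [->|h0] := eqVneq h 0; first by rewrite addr0 subrr mul0r subrr cabs0 mulr0.
  have := rH h; rewrite subr0 => /(_ hr h0) /ltW le.
  have -> : f (z + h) - f z - h * d = (h^-1 *: (f (h + z) - f z) - d) * h.
    by rewrite [_ *: _]mulrC (addrC h) mulrBl divfK// (mulrC d).
  by rewrite cabsM ler_wpM2r// cabs_ge0.
- have e20 : 0 < e / 2 by lra.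
  have [r r0 rH] := H _ e20; apply/nearCP; exists r => // h; rewrite subr0 => hr h0.
  have := rH h hr.
  have -> : f (z + h) - f z - h * d = (h^-1 *: (f (h + z) - f z) - d) * h.
    by rewrite [_ *: _]mulrC (addrC h) mulrBl divfK// (mulrC d).
  rewrite cabsM ler_pM2r ?cabs_gt0//; move: (cabs _) => x; lra.
Qed.
End ComplexAnalysis.

(** * Complex derivatives: calculus rules, right inverses, functions with zero derivative *)

Section ComplexDerivative.
Variable R : realType.
Local Notation C := (Cplx R).
Implicit Types (z w h d a b : C) (f g : C -> C).

Lemma is_derive_derive1 f z d : is_derive z 1 f d -> f^`()%classic z = d.
Proof. by move=> fd; rewrite derive1E derive_val. Qed.

Lemma is_derive_continuous f z d : is_derive z 1 f d -> f @ z --> f z.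
Proof.
move=> fd; apply/differentiable_continuous/derivable1_diffP.
exact: ex_derive.
Qed.

Lemma is_deriveC_id z : is_derive z 1 (fun y : C => y) 1.
Proof. exact: is_derive_id. Qed.

Lemma is_deriveC_cst c z : is_derive z 1 (fun=> c : C) 0.
Proof. exact: is_derive_cst. Qed.

Lemma is_deriveC_add f g z a b : is_derive z 1 f a -> is_derive z 1 g b ->
  is_derive z 1 (fun y => f y + g y) (a + b).
Proof. by move=> fa gb; exact: (is_deriveD fa gb). Qed.

Lemma is_deriveC_sub f g z a b : is_derive z 1 f a -> is_derive z 1 g b ->
  is_derive z 1 (fun y => f y - g y) (a - b).
Proof. by move=> fa gb; exact: (is_deriveB fa gb). Qed.

Lemma is_deriveC_mul f g z a b : is_derive z 1 f a -> is_derive z 1 g b ->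
  is_derive z 1 (fun y => f y * g y) (a * g z + f z * b).
Proof.
move=> fa gb; apply: (is_derive_eq (is_deriveM fa gb)).
by rewrite /GRing.scale /= addrC; congr (_ + _); exact: mulrC.
Qed.

Lemma is_deriveC_inv f z a : f z != 0 -> is_derive z 1 f a ->
  is_derive z 1 (fun y => (f y)^-1) (- a / f z ^+ 2).
Proof.
move=> f0 [fa <-]; split; first exact: derivableV.
by rewrite deriveV// /GRing.scale /= mulrC mulNr -mulrN.
Qed.

Lemma is_deriveC_exp f z a n : is_derive z 1 f a ->
  is_derive z 1 (fun y => f y ^+ n) (n%:R * f z ^+ n.-1 * a).
Proof.
move=> fa; elim: n => [|n IH].
  by rewrite !mul0r; under eq_fun do rewrite expr0; exact: is_derive_cst.
under eq_fun do rewrite exprS.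
apply: is_derive_eq (is_deriveC_mul fa IH) _.
case: n {IH} => [|n]; first by rewrite expr0; ring.
by rewrite /= exprS -[n.+2%:R]natr1; ring.
Qed.

(** Quadratic remainders can be summed over the terms of a series; this is the route to the
    derivatives of [psum], of [cexp], and of the hypergeometric sum in [epsilon]. *)
Lemma is_derive_of_sq f z d (r M : R) : 0 < r ->
  (forall h, cabs h < r -> cabs (f (z + h) - f z - h * d) <= M * cabs h ^+ 2) ->
  is_derive z 1 f d.
Proof.
move=> r0 H; apply/is_deriveCP => e e0.
exists (Num.min r (e / (`|M| + 1))).
  by rewrite lt_min r0 divr_gt0// ltr_wpDl.
move=> h; rewrite lt_min => /andP[hr he]; apply: (le_trans (H _ hr)).
rewrite expr2 mulrA ler_wpM2r ?cabs_ge0//.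
move: he; rewrite ltr_pdivlMr ?ltr_wpDl// => he.
have := cabs_ge0 h; have := ler_norm M; nra.
Qed.

Lemma is_deriveC_comp f g z a b :
  is_derive (g z) 1 f a -> is_derive z 1 g b ->
  is_derive z 1 (fun y => f (g y)) (a * b).
Proof.
move=> /is_deriveCP fa gb; apply/is_deriveCP => e e0.
have A0 := cabs_ge0 a; have B0 := cabs_ge0 b.
have A1 : 0 < cabs a + 1 by lra.
have B1 : 0 < cabs b + 1 by lra.
(* The bound 1 gives [|k| <= (|b| + 1) |h|] for the inner increment [k]; the other bound makes the
   error of [g], multiplied by [a], cost at most half of [e]. *)
pose e1 := Num.min 1 (e / 2 / (cabs a + 1)).
have e10 : 0 < e1 by rewrite lt_min ltr01 !divr_gt0.
have e20 : 0 < e / 2 / (cabs b + 1) by rewrite !divr_gt0.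
have [r r0 rH] := fa _ e20.
have /cvgCP/(_ _ r0)/nearCP[t t0 tH] := is_derive_continuous gb.
move/is_deriveCP : gb => /(_ _ e10)[s s0 sH].
exists (Num.min s t) => [|h]; first by rewrite lt_min s0.
rewrite lt_min => /andP[hs ht].
have := tH (z + h); rewrite addrAC subrr add0r => /(_ ht) kr.
have := rH _ kr; have := sH _ hs; rewrite [g z + _]addrC subrK.
set k := g (z + h) - g z => k1 k2.
have H0 := cabs_ge0 h; have K0 := cabs_ge0 k.
have e1a : e1 <= e / 2 / (cabs a + 1) by rewrite ge_min lexx orbT.
have e11 : e1 <= 1 by rewrite ge_min lexx.
have k3 : cabs k <= (cabs b + 1) * cabs h.
  rewrite -{1}(subrK (h * b) k); apply: (le_trans (cabsD _ _)).
  by rewrite cabsM; nra.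
have -> : f (g (z + h)) - f (g z) - h * (a * b) =
    f (g (z + h)) - f (g z) - k * a + (k - h * b) * a by ring.
apply: (le_trans (cabsD _ _)); rewrite [cabs ((_ - h * b) * _)]cabsM.
have -> : e * cabs h = e / 2 / (cabs b + 1) * ((cabs b + 1) * cabs h)
    + e / 2 / (cabs a + 1) * cabs h * (cabs a + 1).
  by field; rewrite !lt0r_neq0.
apply: lerD; first by apply: (le_trans k2); rewrite ler_wpM2l// ltW.
apply: ler_pM; rewrite ?cabs_ge0//; last by lra.
by apply: (le_trans k1); rewrite ler_wpM2r.
Qed.

(** The increment [k] of [g] satisfies [h = k * d + o(k)], so [k - h / d] is minus the error of [f]
    divided by [d]; it remains to compare [k] with [h]. *)
Lemma is_derive_right_inverse f g w d :
  g @ w --> g w -> (\forall w' \near w, f (g w') = w') -> d != 0 ->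
  is_derive (g w) 1 f d -> is_derive w 1 g d^-1.
Proof.
move=> gc fg d0 /is_deriveCP fd; apply/is_deriveCP => e e0.
have D0 : 0 < cabs d by rewrite cabs_gt0.
(* The first bound absorbs the error term and yields [|k| |d| <= 2 |h|]; the second is what the
   final estimate then requires. *)
pose e1 := Num.min (cabs d / 2) (e * cabs d ^+ 2 / 2).
have e10 : 0 < e1 by rewrite lt_min !divr_gt0// mulr_gt0// exprn_gt0.
have [r r0 rH] := fd _ e10.
move/cvgCP : gc => /(_ _ r0) gr.
have fgw : f (g w) = w by exact: nbhs_singleton fg.
have /nearCP[s s0 sH] : \forall w' \near w, cabs (g w' - g w) < r /\ f (g w') = w'.
  by near=> w'; split; near: w'.
exists s => // h hs.
have [] := sH (w + h); first by rewrite addrAC subrr add0r.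
set k := g (w + h) - g w => kr fk.
have := rH k kr; rewrite [g w + _]addrC subrK fk fgw [w + h - w]addrAC subrr add0r => le1.
have K0 := cabs_ge0 k.
have le2 : cabs k * cabs d <= cabs h + e1 * cabs k.
  rewrite -cabsM -{1}(subKr h (k * d)); apply: (le_trans (cabsB _ _)).
  by rewrite lerD2l.
have e1d : e1 <= cabs d / 2 by rewrite ge_min lexx.
have e1e : e1 <= e * cabs d ^+ 2 / 2 by rewrite ge_min lexx orbT.
have le3 : cabs k * cabs d <= 2 * cabs h by nra.
have -> : k - h * d^-1 = - (h - k * d) / d by field.
rewrite cabsM cabsN cabsV ler_pdivrMr//.
apply: (le_trans le1); apply: (le_trans (ler_wpM2r K0 e1e)).
have -> : e * cabs d ^+ 2 / 2 * cabs k = (e * cabs d / 2) * (cabs k * cabs d).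
  by rewrite expr2; field.
rewrite (_ : e * cabs h * cabs d = (e * cabs d / 2) * (2 * cabs h)); last by field.
by rewrite ler_wpM2l// !mulr_ge0// ?ltW// invr_gt0.
Unshelve. all: by end_near. Qed.

Lemma near_constant_of_derive0 f (r : R) z :
  (forall w, cabs w < r -> exists d, is_derive w 1 f d) ->
  (forall w, cabs w < r -> w != 0 -> is_derive w 1 f 0) ->
  cabs z < r -> f z = f 0.
Proof.
move=> fder fd0 zr.
have [->//|z0] := eqVneq z 0.
have tzr (t : R) : 0 <= t <= 1 -> cabs (ofR t * z) < r.
  move=> /andP[t0 t1]; rewrite cabsM cabs_ofR ger0_norm//.
  by apply: le_lt_trans zr; rewrite ler_piMl// cabs_ge0.
suff key (p : C -> R) : (forall x y, p (x - y) = p x - p y) ->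
    (forall x, `|p x| <= cabs x) -> p (f z) = p (f 0).
  apply/eqP; rewrite eq_complex; apply/andP; split; apply/eqP.
    by apply: (key (@complex.Re R)); [case=> a b [c d] | exact: Re_le_cabs].
  by apply: (key (@complex.Im R)); [case=> a b [c d] | exact: Im_le_cabs].
move=> pB ple; pose F (t : R) := p (f (ofR t * z)).
have Fc (t : R) : 0 <= t <= 1 -> {for t, continuous F}.
  move=> t01; have [d fd] := fder _ (tzr t t01).
  apply/(@cvgrPdist_lt _ R^o) => e e0.
  have /cvgCP/(_ _ e0)/nearCP[s s0 sH] := is_derive_continuous fd.
  apply/nbhs_ballP; exists (s / cabs z); first by rewrite /= divr_gt0// cabs_gt0.
  move=> u; rewrite /ball /= ltr_pdivlMr ?cabs_gt0// => us.
  rewrite /F -pB; apply: le_lt_trans (ple _) _; rewrite cabs_distC; apply: sH.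
  rewrite -mulrBl cabsM cabs_distC -[ofR t - ofR u](rmorphB (real_complex R)).
  by rewrite cabs_ofR.
have Fd (t : R) : t \in `]0, 1[%R -> is_derive t (1 : R) F 0.
  rewrite in_itv /= => /andP[t0 t1].
  have t01 : 0 <= t <= 1 by rewrite !ltW.
  have /is_deriveCP fd : is_derive (ofR t * z) 1 f 0.
    apply: fd0; first exact: tzr.
    by rewrite mulf_neq0// -cabs_gt0 cabs_ofR normr_gt0 gt_eqF.
  have cF : (fun h : R => h^-1 *: (F (h *: 1 + t) - F t)) @ 0^' --> (0 : R).
    apply/(@cvgrPdist_le _ R^o) => e e0.
    have ez0 : 0 < e / cabs z by rewrite divr_gt0// cabs_gt0.
    have [s s0 sH] := fd _ ez0.
    apply/nbhs_ballP; exists (s / cabs z); first by rewrite /= divr_gt0// cabs_gt0.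
    move=> u; rewrite /ball /= sub0r normrN ltr_pdivlMr ?cabs_gt0// => us u0.
    rewrite sub0r normrN [_ *: 1]mulr1 normrM normfV ler_pdivrMl ?normr_gt0//.
    rewrite /F -pB; apply: le_trans (ple _) _.
    have := sH (ofR u * z); rewrite cabsM cabs_ofR => /(_ us).
    rewrite mulr0 subr0 -mulrDl -ofRD (addrC t) => /le_trans; apply.
    by rewrite mulrCA mulfVK ?cabs_eq0// mulrC.
  by split; [apply/cvg_ex; exists 0 | exact: cvg_lim].
have Fw : {within `[0, 1], continuous F}.
  apply/continuous_in_subspaceT => t; rewrite inE /= in_itv /=; exact: Fc.
have [c _] := MVT_segment ler01 Fd Fw.
rewrite mul0r /F => /eqP; rewrite subr_eq0 => /eqP.
by rewrite /ofR rmorph1 rmorph0 mul1r mul0r.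
Qed.

End ComplexDerivative.

Ltac is_deriveC_hyp F := match goal with
  | H : is_derive _ _ F _ |- _ => exact H
  | H : forall i, is_derive _ _ (@?G i) _ |- _ =>
    match F with ?h ?i => unify (G i) F; exact (H i) end
  end.

(* [is_derive] is a class: a plain [refine] or [apply] would start an instance
   search (which diverges here) for the derivatives left open. *)
Ltac is_deriveC_tac R := lazymatch goal with
  | |- is_derive _ _ (fun _ => ?c) _ => exact (@is_deriveC_cst R c _)
  | |- is_derive _ _ (fun y => y) _ => exact (@is_deriveC_id R _)
  | |- is_derive _ _ (fun y => Algebra.add (@?f y) (Algebra.opp (@?g y))) _ =>
    notypeclasses refine (@is_deriveC_sub R f g _ _ _ _ _); is_deriveC_tac R
  | |- is_derive _ _ (fun y => Algebra.add (@?f y) (@?g y)) _ =>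
    notypeclasses refine (@is_deriveC_add R f g _ _ _ _ _); is_deriveC_tac R
  | |- is_derive _ _ (fun y => GRing.mul (@?f y) (@?g y)) _ =>
    notypeclasses refine (@is_deriveC_mul R f g _ _ _ _ _); is_deriveC_tac R
  | |- is_derive _ _ (fun y => GRing.exp (@?f y) ?n) _ =>
    notypeclasses refine (@is_deriveC_exp R f _ _ n _); is_deriveC_tac R
  | |- is_derive _ _ (fun y => ?F y) _ => is_deriveC_hyp F
  | |- is_derive _ _ ?F _ => is_deriveC_hyp F
  end.

(** * Power series *)

Section PowerSeries.
Variable R : realType.
Local Notation C := (Cplx R).
Implicit Types (z w h l : C) (a b u v : nat -> C).

(** Real and imaginary parts are each dominated by a real geometric series. *)
Lemma series_cvg_geometric u (M s : R) : 0 <= s < 1 ->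
  (forall n, cabs (u n) <= M * s ^+ n) -> series u @ \oo --> limn (series u).
Proof.
move=> /andP[s0 s1] uM.
have key (p : C -> R) : {morph p : x y / x + y} -> p 0 = 0 ->
    (forall x, `|p x| <= cabs x) -> cvgn (series (p \o u)).
  move=> pD p0 ple; apply: normed_cvg.
  apply: (@series_le_cvg _ _ (geometric M s)) => [n|n|n|] /=.
  - exact: normr_ge0.
  - exact: le_trans (cabs_ge0 _) (uM n).
  - exact: le_trans (ple _) (uM n).
  - by apply: is_cvg_geometric_series; rewrite ger0_norm.
have ReD : {morph (@complex.Re R : C -> R) : x y / x + y} by case=> ? ? [].
have ImD : {morph (@complex.Im R : C -> R) : x y / x + y} by case=> ? ? [].
have cRe := key (@complex.Re R) ReD erefl (@Re_le_cabs R).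
have cIm := key (@complex.Im R) ImD erefl (@Im_le_cabs R).
have pE (p : C -> R) n : {morph p : x y / x + y} -> p 0 = 0 ->
    p (series u n) = series (p \o u) n.
  by move=> pD p0; rewrite /series /= (big_morph p pD p0).
suff cu : series u @ \oo -->
    ((limn (series (@complex.Re R \o u)) +i* limn (series (@complex.Im R \o u)))%C : C).
  by rewrite (cvg_lim _ cu).
apply/cvgCP => e e0; have e20 : 0 < e / 2 by lra.
move/(@cvgrPdist_lt _ R^o)/(_ _ e20) : cRe => cRe.
move/(@cvgrPdist_lt _ R^o)/(_ _ e20) : cIm => cIm.
near=> n; apply: (le_lt_trans (cabs_le_ReIm _)).
have := pE (@complex.Re R) n ReD erefl; have := pE (@complex.Im R) n ImD erefl.
case: (series u n) => x y /= -> ->; rewrite (splitr e).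
by apply: ltrD; rewrite -normrN opprB; near: n.
Unshelve. all: by end_near. Qed.

Lemma cabs_limn_le (x_ : nat -> C) l (B : R) :
  x_ @ \oo --> l -> (forall n, cabs (x_ n) <= B) -> cabs l <= B.
Proof.
move=> /cvgCP xl xB; apply/ler_addgt0Pr => e /xl[N _ /(_ N (leqnn N))].
rewrite cabs_distC => /ltW xNl.
rewrite -(subrK (x_ N) l) addrC; apply: (le_trans (cabsD _ _)).
exact: lerD (xB N) xNl.
Qed.

Lemma cabs_series_le u (M s : R) : 0 <= s < 1 ->
  (forall n, cabs (u n) <= M * s ^+ n) -> cabs (limn (series u)) <= M / (1 - s).
Proof.
move=> s01 uM; have /andP[s0 s1] := s01.
apply: (cabs_limn_le (series_cvg_geometric s01 uM)) => n.
have M0 : 0 <= M by have := uM 0%N; rewrite expr0 mulr1; apply: le_trans (cabs_ge0 _).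
(* The exact geometric partial sum is the bound that induction on [n] can carry. *)
apply: (@le_trans _ _ (M * (1 - s ^+ n) / (1 - s))); last first.
  apply: ler_wpM2r; first by rewrite invr_ge0 subr_ge0 ltW.
  by rewrite ler_piMr// gerBl exprn_ge0.
rewrite /series /=; elim: n => [|n IH].
  by rewrite big_geq// cabs0 expr0 subrr mulr0 mul0r.
rewrite big_nat_recr//=; apply: (le_trans (cabsD _ _)).
apply: (le_trans (lerD IH (uM n))); rewrite exprS le_eqVlt; apply/orP; left.
by apply/eqP; field; rewrite subr_eq0 gt_eqF.
Qed.

Lemma cvg_series_shift u l :
  series (fun n => u n.+1) @ \oo --> l -> series u @ \oo --> u 0%N + l.
Proof.
move=> ul; rewrite -cvg_shiftS.
rewrite (_ : (fun n => _) = (fun n => u 0%N + series (fun k => u k.+1) n)).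
  by apply: cvgD; [exact: cvg_cst|].
by apply/funext => n; rewrite /series /= big_nat_recl.
Qed.

(* The radius of convergence is at least 1. *)
Definition unit_radius a := forall r : R, 0 <= r < 1 ->
  exists M : R, forall n, cabs (a n) * r ^+ n <= M.

(** Boundedness at [m], midway between [r] and 1, becomes decay at [r] with ratio [r / m]. *)
Lemma unit_radius_geometric a (r : R) : unit_radius a -> 0 <= r < 1 ->
  exists M s : R, 0 <= s < 1 /\ forall n, cabs (a n) * r ^+ n <= M * s ^+ n.
Proof.
move=> ua /andP[r0 r1]; pose m := (1 + r) / 2.
have m01 : 0 <= m < 1 by apply/andP; split; rewrite /m; lra.
have m0 : 0 < m by rewrite /m; lra.
have [M MP] := ua m m01; exists M, (r / m); split.
  by apply/andP; split; [rewrite divr_ge0// ltW | rewrite ltr_pdivrMr// mul1r /m; lra].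
move=> n; rewrite expr_div_n -{1}(divfK (lt0r_neq0 (exprn_gt0 n m0)) (r ^+ n)).
rewrite mulrCA mulrC ler_wpM2r//.
  by rewrite divr_ge0// exprn_ge0// ltW.
Qed.

(** In [1 - s^n = (1 - s) (1 + s + ... + s^(n-1))] each of the [n] summands is at least [s^n]. *)
Lemma natmul_exp_le (s : R) n : 0 <= s < 1 -> n%:R * s ^+ n <= (1 - s)^-1.
Proof.
move=> /andP[s0 s1]; rewrite -[leRHS]mul1r ler_pdivlMr ?subr_gt0//.
suff : n%:R * s ^+ n * (1 - s) <= 1 - s ^+ n.
  by move=> /le_trans; apply; rewrite gerBl exprn_ge0.
elim: n => [|n IH]; first by rewrite !mul0r expr0 subrr.
rewrite -natr1 exprS.
have p0 : 0 <= s ^+ n by rewrite exprn_ge0.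
have p1 : s ^+ n <= 1 by rewrite exprn_ile1// ltW.
move: IH p0 p1; set p := s ^+ n; set k := n%:R => IH p0 p1.
have sp1 : s * p <= 1 by rewrite mulr_ile1// ltW.
have : 0 <= (1 - s) * (1 - s * p) by rewrite mulr_ge0// subr_ge0// ltW.
by have := ler_wpM2l s0 IH; lra.
Qed.

Lemma unit_radius_nat a : unit_radius a -> unit_radius (fun n => n%:R * a n).
Proof.
move=> ua r r01; have [M [s [s01 Ms]]] := unit_radius_geometric ua r01.
have M0 : 0 <= M.
  have := Ms 0%N; rewrite !expr0 !mulr1; apply: le_trans; exact: cabs_ge0.
exists (M / (1 - s)) => n; rewrite cabsM cabs_nat -mulrA.
apply: (le_trans (ler_wpM2l (ler0n _ n) (Ms n))).
by rewrite mulrCA ler_wpM2l// natmul_exp_le.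
Qed.

Lemma unit_radius_natX a k :
  unit_radius a -> unit_radius (fun n => n%:R ^+ k * a n).
Proof.
move=> ua; elim: k => [|k IH].
  by under eq_fun do rewrite expr0 mul1r.
by under eq_fun do rewrite exprS -mulrA; exact: unit_radius_nat.
Qed.

Lemma unit_radius_shift a : unit_radius a -> unit_radius (fun n => a n.+1).
Proof.
move=> ua r /andP[r0 r1]; pose m := (1 + r) / 2.
have m01 : 0 <= m < 1 by apply/andP; split; rewrite /m; lra.
have m0 : 0 < m by rewrite /m; lra.
have [M MP] := ua m m01; exists (M / m) => n; rewrite ler_pdivlMr//.
apply: le_trans (MP n.+1); rewrite exprSr mulrA ler_wpM2r//; first exact: ltW.
rewrite ler_wpM2l ?cabs_ge0// lerXn2r ?nnegrE// /m; lra.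
Qed.

Definition psum a z : C := limn (series (fun n => a n * z ^+ n)).

Lemma psum_cvg a z : unit_radius a -> cabs z < 1 ->
  series (fun n => a n * z ^+ n) @ \oo --> psum a z.
Proof.
move=> ua z1; have [|M [s [s01 Ms]]] := unit_radius_geometric (r := cabs z) ua.
  by rewrite cabs_ge0.
by apply: (series_cvg_geometric s01 (M := M)) => n; rewrite cabsM cabsX.
Qed.

Lemma psum_eq a z l : series (fun n => a n * z ^+ n) @ \oo --> l -> psum a z = l.
Proof. by move=> al; exact: cvg_lim. Qed.

Lemma psumD a b z : unit_radius a -> unit_radius b -> cabs z < 1 ->
  psum (fun n => a n + b n) z = psum a z + psum b z.
Proof.
move=> ua ub z1; apply: psum_eq.
under eq_fun do rewrite mulrDl.
rewrite [series _](seriesD (fun n => a n * z ^+ n) (fun n => b n * z ^+ n)).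
by apply: cvgD; exact: psum_cvg.
Qed.

Lemma psumZ c a z : unit_radius a -> cabs z < 1 ->
  psum (fun n => c * a n) z = c * psum a z.
Proof.
move=> ua z1; apply: psum_eq.
rewrite (_ : series _ = (fun n => c * series (fun n => a n * z ^+ n) n)).
  by apply: cvgM; [exact: cvg_cst | exact: psum_cvg].
apply/funext => n; rewrite /series /= big_distrr/=.
by apply: eq_bigr => i _; rewrite mulrA.
Qed.

Lemma psum_shift a z : unit_radius a -> cabs z < 1 ->
  psum a z = a 0%N + z * psum (fun n => a n.+1) z.
Proof.
move=> ua z1; apply: psum_eq.
rewrite -[X in X + _]mulr1 -(expr0 z).
apply: (cvg_series_shift (u := fun n => a n * z ^+ n)).
rewrite (_ : series _ = (fun n => z * series (fun n => a n.+1 * z ^+ n) n)).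
  apply: cvgM; [exact: cvg_cst | apply: psum_cvg => //].
  exact: unit_radius_shift.
apply/funext => n; rewrite /series /= big_distrr/=.
by apply: eq_bigr => i _; rewrite exprS mulrCA.
Qed.

Lemma psum0 a : unit_radius a -> psum a 0 = a 0%N.
Proof. by move=> ua; rewrite psum_shift ?cabs0// mul0r addr0. Qed.

(** The remainders satisfy [R_(n+1) = (z + h) R_n + h^2 n z^(n-1)]. The factor [r ^+ 2] on the left
    replaces [r^(n-2)] on the right, which avoids both a division and small exponents. *)
Lemma expr_remainder2 z h (r : R) n : cabs z <= r -> cabs (z + h) <= r ->
  cabs ((z + h) ^+ n - z ^+ n - h * (n%:R * z ^+ n.-1)) * r ^+ 2
    <= n%:R ^+ 2 * r ^+ n * cabs h ^+ 2.
Proof.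
move=> zr zhr; have r0 : 0 <= r := le_trans (cabs_ge0 z) zr.
elim: n => [|n IH].
  by rewrite !expr0 subrr mul0r mulr0 subr0 cabs0 expr0n !mul0r.
have -> : (z + h) ^+ n.+1 - z ^+ n.+1 - h * (n.+1%:R * z ^+ n.+1.-1) =
   (z + h) * ((z + h) ^+ n - z ^+ n - h * (n%:R * z ^+ n.-1))
   + h ^+ 2 * (n%:R * z ^+ n.-1).
  case: n {IH} => [|n]; first by rewrite /= !expr1 !expr0; ring.
  by rewrite /= -[n.+2%:R]natr1 !exprS; ring.
apply: (@le_trans _ _ (r * (n%:R ^+ 2 * r ^+ n * cabs h ^+ 2)
    + cabs h ^+ 2 * (n%:R * (cabs z ^+ n.-1 * r ^+ 2)))).
  apply: le_trans (ler_wpM2r (exprn_ge0 _ r0) (cabsD _ _)) _.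
  rewrite mulrDl; apply: lerD.
    rewrite cabsM -[leLHS]mulrA; apply: ler_pM => //; first exact: cabs_ge0.
    by rewrite mulr_ge0 ?cabs_ge0// exprn_ge0.
  by rewrite !cabsM !cabsX cabs_nat -!mulrA.
have nz : n%:R * (cabs z ^+ n.-1 * r ^+ 2) <= n%:R * r ^+ n.+1 :> R.
  case: n {IH} => [|n]; first by rewrite !mul0r.
  rewrite ler_wpM2l//= -[n.+2]addn2 exprD ler_wpM2r ?exprn_ge0//.
  by rewrite lerXn2r ?nnegrE ?cabs_ge0.
apply: le_trans (lerD (lexx _) (ler_wpM2l (sqr_ge0 _) nz)) _.
rewrite -natr1 (exprS r n); set k := n%:R; set p := r ^+ n; set q := cabs h ^+ 2.
have k0 : 0 <= k by rewrite ler0n.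
have rp0 : 0 <= r * p by rewrite mulr_ge0// exprn_ge0.
have q0 : 0 <= q by rewrite sqr_ge0.
have : 0 <= r * p * q * (k + 1).
  by apply: mulr_ge0; [exact: mulr_ge0 | exact: addr_ge0].
lra.
Qed.

(** With [r] midway between [|z|] and 1, [z + h] stays in the disc of radius [r] for small [h], and
    the termwise remainders are dominated by [n^2 |a_n| r^n], which decays geometrically. *)
Lemma is_derive_psum a z : unit_radius a -> cabs z < 1 ->
  is_derive z 1 (psum a) (psum (fun n => n.+1%:R * a n.+1) z).
Proof.
move=> ua z1; pose r := (1 + cabs z) / 2; have z0 := cabs_ge0 z.
have r0 : 0 < r by rewrite /r; lra.
have r01 : 0 <= r < 1 by apply/andP; split; rewrite /r; lra.
have [M [s [s01 Ms]]] := unit_radius_geometric (unit_radius_natX 2 ua) r01.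
apply: (is_derive_of_sq (r := r - cabs z) (M := M / (1 - s) / r ^+ 2)).
  by rewrite /r; lra.
move=> h hr; have zr : cabs z <= r by rewrite /r; lra.
have zhr : cabs (z + h) <= r by apply: (le_trans (cabsD _ _)); lra.
pose R_ n := a n * ((z + h) ^+ n - z ^+ n - h * (n%:R * z ^+ n.-1)).
have r21 : 0 < r ^+ 2 by rewrite exprn_gt0.
have R_le n : cabs (R_ n) <= (M * cabs h ^+ 2 / r ^+ 2) * s ^+ n.
  rewrite cabsM mulrAC ler_pdivlMr// -mulrA.
  apply: le_trans (ler_wpM2l (cabs_ge0 _) (expr_remainder2 n zr zhr)) _.
  have := ler_wpM2l (sqr_ge0 (cabs h)) (Ms n).
  rewrite cabsM cabsX cabs_nat; congr (_ <= _); ring.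
have <- : limn (series R_) = psum a (z + h) - psum a z
    - h * psum (fun n => n.+1%:R * a n.+1) z.
  apply: cvg_lim => //.
  rewrite (_ : series R_ = (fun n => series (fun n => a n * (z + h) ^+ n) n
      - series (fun n => a n * z ^+ n) n
      - h * series (fun n => n%:R * a n * z ^+ n.-1) n)); last first.
    apply/funext => n; rewrite /series /= big_distrr/= -!sumrB.
    by apply: eq_bigr => i _; rewrite /R_; ring.
  apply: cvgB.
    apply: cvgB; apply: psum_cvg => //.
    by apply: le_lt_trans zhr _; case/andP : r01.
  apply: cvgM; first exact: cvg_cst.
  rewrite -[psum _ z]add0r.
  have -> : 0 = 0%:R * a 0%N * z ^+ 0.-1 :> C by rewrite !mul0r.
  apply: (cvg_series_shift (u := fun n => n%:R * a n * z ^+ n.-1)).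
  apply: psum_cvg => //.
  exact: (unit_radius_shift (unit_radius_nat ua)).
apply: (le_trans (cabs_series_le s01 R_le)).
by rewrite le_eqVlt; apply/orP; left; apply/eqP; ring.
Qed.

Lemma mul_derive_psum a z : unit_radius a -> cabs z < 1 ->
  z * (psum a)^`()%classic z = psum (fun n => n%:R * a n) z.
Proof.
move=> ua z1; rewrite (is_derive_derive1 (is_derive_psum ua z1)).
by rewrite [RHS]psum_shift// ?mul0r ?add0r//; exact: unit_radius_nat.
Qed.

End PowerSeries.

(** * The complex exponential and branches of the logarithm *)

Section RealBounds.
Variable R : realType.
Implicit Types x y : R.

(** Applied in turn to [sin y], [cos y] and [sin y - y], where each bound feeds the next; only the
    orders 1, 2, 3 matter, not sharp constants. *)
Lemma mean_value_bound (f df : R -> R) (y B : R) :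
  (forall x, is_derive x (1 : R) f (df x)) ->
  (forall c, `|c| <= `|y| -> `|df c| <= B) -> `|f y - f 0| <= B * `|y|.
Proof.
move=> fd dfB.
have fc a b : {within `[a, b], continuous f}.
  apply: continuous_subspaceT => x.
  by apply/differentiable_continuous/derivable1_diffP; case: (fd x).
have [y0|/ltW y0] := leP 0 y.
  have [c cy ->] := MVT_segment y0 (fun x _ => fd x) (fc 0 y).
  rewrite subr0 normrM ler_wpM2r// dfB//.
  by move: cy; rewrite in_itv /= => /andP[c0 cy]; rewrite !ger0_norm.
have [c cy cE] := MVT_segment y0 (fun x _ => fd x) (fc y 0).
rewrite distrC cE sub0r normrM normrN ler_wpM2r// dfB//.
by move: cy; rewrite in_itv /= => /andP[c0 cy]; rewrite !ler0_norm// lerN2.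
Qed.

Lemma normr_sin_le y : `|sin y| <= `|y|.
Proof.
rewrite -[sin y]subr0 -(sin0 R) -[leRHS]mul1r.
by apply: (@mean_value_bound _ cos) => // c _; exact: cos_max.
Qed.

Lemma normr_cos_sub1_le y : `|cos y - 1| <= `|y| ^+ 2.
Proof.
rewrite -(cos0 R) expr2; apply: (@mean_value_bound _ (fun x => - sin x)) => c cy.
by rewrite normrN (le_trans (normr_sin_le _)).
Qed.

Lemma normr_sin_subid_le y : `|sin y - y| <= `|y| ^+ 3.
Proof.
have -> : sin y - y = (sin y - y) - (sin 0 - 0) by rewrite sin0 !subr0.
rewrite exprSr; apply: (@mean_value_bound (fun x => sin x - x) (fun x => cos x - 1)).
move=> c cy; apply: le_trans (normr_cos_sub1_le _) _.
by rewrite lerXn2r ?nnegrE.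
Qed.

(** Both bounds come from [1 + y <= expR y], taken at [x] and at [- x]; the latter gives
    [expR x * (1 - x) <= 1]. *)
Lemma expR_sub1_le x : `|x| <= 1 / 2 ->
  `|expR x - 1 - x| <= 2 * `|x| ^+ 2 /\ expR x <= 2.
Proof.
move=> x2; have x1 : `|x| < 1 by lra.
have /andP[xl xu] : - (1 / 2) <= x <= 1 / 2 by rewrite -ler_norml.
have e1 := expR_ge1Dx x; have e2 := expR_ge1Dx (- x).
have e3 : expR x * expR (- x) = 1 by rewrite -expRD subrr expR0.
have e0 := expR_gt0 x.
have e4 : expR x * (1 - x) <= 1 by rewrite -[leRHS]e3 ler_wpM2l// ltW.
split; last nra.
rewrite ger0_norm; last lra.
rewrite real_normK ?num_real//.
have : 0 <= (expR x - 1 - x) * (1 / 2 - x) by apply: mulr_ge0; lra.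
move: e4; rewrite expr2; set E := expR x; lra.
Qed.

End RealBounds.

Section ComplexExponential.
Variable R : realType.
Local Notation C := (Cplx R).
Implicit Types (z w h : C) (U : set C) (L : C -> C).

Lemma cexpD z w : cexp (z + w) = cexp z * cexp w.
Proof.
case: z w => [a b] [c d]; rewrite /cexp /= expRD cosD sinD.
apply/eqP; rewrite eq_complex /=; apply/andP; split; apply/eqP; ring.
Qed.

Lemma cexp0 : cexp 0 = 1 :> C.
Proof. by rewrite /cexp /= expR0 cos0 sin0 mulr1 mulr0. Qed.

Lemma cexp_neq0 z : cexp z != 0.
Proof.
apply/eqP => z0; have := cexpD z (- z).
by rewrite subrr cexp0 z0 mul0r => /eqP; rewrite oner_eq0.
Qed.

Lemma cexp_natl n z : cexp (n%:R * z) = cexp z ^+ n.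
Proof.
elim: n => [|n IH]; first by rewrite mul0r cexp0 expr0.
by rewrite -natr1 mulrDl mul1r cexpD IH exprSr.
Qed.

Lemma cabs_cexp_sub1_le h : cabs h <= 1 / 2 ->
  cabs (cexp h - 1 - h) <= 8 * cabs h ^+ 2.
Proof.
set t := cabs h => t2.
apply: (le_trans (cabs_le_ReIm _)).
have := Re_le_cabs h; have := Im_le_cabs h; rewrite -/t.
case: h @t t2 => x y t t2 /= yt xt; have t0 : 0 <= t by exact: cabs_ge0.
have [ex ex2] := expR_sub1_le (le_trans xt t2).
have cy := normr_cos_sub1_le y; have sy := normr_sin_subid_le y.
have x2t : `|x| ^+ 2 <= t ^+ 2 by rewrite lerXn2r ?nnegrE.
have y2t : `|y| ^+ 2 <= t ^+ 2 by rewrite lerXn2r ?nnegrE.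
have y3t : `|y| ^+ 3 <= t ^+ 2 / 2.
  apply: (@le_trans _ _ (t ^+ 3)); first by rewrite lerXn2r ?nnegrE.
  by rewrite exprSr ler_wpM2l ?sqr_ge0//; lra.
have e0 := expR_ge0 x.
have ->: expR x * cos y - 1 - x = expR x * (cos y - 1) + (expR x - 1 - x) by ring.
have ->: expR x * sin y - 0 - y = expR x * (sin y - y) + (expR x - 1 - x) * y + x * y.
  by ring.
have B1 : `|expR x * (cos y - 1)| <= 2 * t ^+ 2.
  by rewrite normrM (ger0_norm e0) ler_pM// (le_trans cy).
have B2 : `|expR x * (sin y - y)| <= 2 * (t ^+ 2 / 2).
  by rewrite normrM (ger0_norm e0) ler_pM// (le_trans sy).
have B3 : `|(expR x - 1 - x) * y| <= (2 * t ^+ 2) * (1 / 2).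
  rewrite normrM ler_pM//; last exact: le_trans yt t2.
  by apply: (le_trans ex); rewrite ler_wpM2l.
have B4 : `|x * y| <= t ^+ 2 by rewrite normrM expr2 ler_pM.
(* The real part contributes [4 t^2] and the imaginary part [3 t^2], together below [8 t^2]. *)
apply: (@le_trans _ _ ((2 * t ^+ 2 + 2 * t ^+ 2)
    + (2 * (t ^+ 2 / 2) + 2 * t ^+ 2 * (1 / 2) + t ^+ 2))); last first.
  by move: (sqr_ge0 t); lra.
apply: lerD.
  apply: le_trans (ler_normD _ _) _; apply: lerD => //.
  by apply: (le_trans ex); rewrite ler_wpM2l.
apply: le_trans (ler_normD _ _) _; apply: lerD => //.
by apply: le_trans (ler_normD _ _) _; exact: lerD.
Qed.

Lemma is_derive_cexp z : is_derive z 1 (@cexp R) (cexp z).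
Proof.
apply: (is_derive_of_sq (r := 1 / 2) (M := cabs (cexp z) * 8)); first by lra.
move=> h /ltW hr; rewrite cexpD -mulrA.
have -> : cexp z * cexp h - cexp z - h * cexp z = cexp z * (cexp h - 1 - h) by ring.
by rewrite cabsM ler_wpM2l ?cabs_ge0// cabs_cexp_sub1_le.
Qed.

Lemma log_branch_neq0 U L z : log_branch U L -> U z -> z != 0.
Proof. by move=> [_ _ LK] /LK <-; exact: cexp_neq0. Qed.

Lemma is_derive_log_branch U L z : log_branch U L -> U z -> is_derive z 1 L z^-1.
Proof.
move=> UL Uz; have z0 := log_branch_neq0 UL Uz; have [oU cL LK] := UL.
apply: (@is_derive_right_inverse _ (@cexp R)) => //.
- by apply: cL; rewrite inE.
- by apply: filterS (open_nbhs_nbhs (conj oU Uz)) => w; exact: LK.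
- by rewrite -{2}(LK z Uz); exact: is_derive_cexp.
Qed.

End ComplexExponential.

(** * A local inverse theorem *)

Section LocalInverse.
Variable R : realType.
Local Notation C := (Cplx R).
Implicit Types (z w h : C).

Lemma local_inverse (Q G : C -> C) (rho K : R) : 0 < rho -> G 0 != 0 ->
  (forall z, cabs z < rho -> Q z = z * G z) ->
  (forall z w, cabs z < rho -> cabs w < rho ->
    cabs (G z - G w) <= K * cabs (z - w)) ->
  (forall z, cabs z < rho -> derivable Q z 1) ->
  exists (V : set C) (P : C -> C),
    [/\ open V, V 0, (forall w, V w -> cabs (P w) < rho /\ derivable P w 1) &
    \forall z \near (0 : C), V (Q z) /\ P (Q z) = z].
Proof.
move=> rho0 c0 QG GK Qd; set c := G 0 in c0.
have cgt0 : 0 < cabs c by rewrite cabs_gt0.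
pose K1 := `|K| + 1.
have K10 : 0 < K1 by rewrite /K1 ltr_wpDl.
have GK1 z w : cabs z < rho -> cabs w < rho ->
    cabs (G z - G w) <= K1 * cabs (z - w).
  move=> zr wr; apply: (le_trans (GK _ _ zr wr)).
  by rewrite ler_wpM2r ?cabs_ge0// /K1; have := ler_norm K; lra.
(* Half of [rho] keeps the closed ball in the domain; [K1 * delta <= |c| / 4] makes [Q z - c * z]
   Lipschitz with constant [|c| / 2]. *)
pose delta := Num.min (rho / 2) (cabs c / (4 * K1)).
have delta0 : 0 < delta by rewrite lt_min !divr_gt0// mulr_gt0.
have delta_rho : delta < rho.
  by rewrite /delta gt_min; apply/orP; left; rewrite ltr_pdivrMr//; lra.
have deltaK : K1 * delta <= cabs c / 4.
  apply: (@le_trans _ _ (K1 * (cabs c / (4 * K1)))).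
    by rewrite (ler_wpM2l (ltW K10))// ge_min lexx orbT.
  by rewrite le_eqVlt; apply/orP; left; apply/eqP; field; rewrite lt0r_neq0.
have ltr z : cabs z <= delta -> cabs z < rho by move=> /le_lt_trans; apply.
have Q0 : Q 0 = 0 by rewrite QG ?cabs0// mul0r.
have almost_linear z z' : cabs z <= delta -> cabs z' <= delta ->
    cabs (Q z - Q z' - c * (z - z')) <= cabs c / 2 * cabs (z - z').
  move=> zd z'd; rewrite !QG ?ltr//.
  have -> : z * G z - z' * G z' - c * (z - z') =
     (z - z') * (G z - c) + z' * (G z - G z') by ring.
  apply: (le_trans (cabsD _ _)); rewrite !cabsM.
  have l1 : cabs (G z - c) <= cabs c / 4.
    have := GK1 z 0 (ltr _ zd); rewrite cabs0 subr0 => /(_ rho0).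
    move=> /le_trans; apply; apply: le_trans deltaK; by rewrite (ler_wpM2l (ltW K10)).
  have l2 : cabs z' * cabs (G z - G z') <= cabs c / 4 * cabs (z - z').
    apply: (@le_trans _ _ (delta * (K1 * cabs (z - z')))).
      by apply: ler_pM => //; rewrite ?cabs_ge0// GK1// ltr.
    by rewrite mulrA [delta * K1]mulrC ler_wpM2r ?cabs_ge0.
  have l3 : cabs (z - z') * cabs (G z - c) <= cabs c / 4 * cabs (z - z').
    by rewrite mulrC ler_wpM2r ?cabs_ge0.
  apply: (le_trans (lerD l3 l2)); rewrite -mulrDl ler_wpM2r ?cabs_ge0//; lra.
(* This lower bound serves three times: continuity of [P], nonvanishing of the derivative of [Q],
   and [P (Q z) = z]. *)
have Q_expanding z z' : cabs z <= delta -> cabs z' <= delta ->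
    cabs c / 2 * cabs (z - z') <= cabs (Q z - Q z').
  move=> zd z'd; have := almost_linear _ _ zd z'd.
  have := cabs_sub_ge (c * (z - z')) (Q z - Q z').
  by rewrite (cabs_distC (c * _)) cabsM; lra.
(* For such [w] the first iterate has modulus at most [delta / 4]; since the map halves distances,
   all iterates stay within [delta / 2]. *)
pose V : set C := [set w | cabs w < cabs c * delta / 4].
have sol w : V w -> exists2 z, cabs z <= delta / 2 & Q z = w.
  rewrite /V /= => wV; pose T z := z + (w - Q z) / c.
  have TE z z' : T z - T z' = - (Q z - Q z' - c * (z - z')) / c.
    by rewrite /T; field.
  have Tcontr z z' : cabs z <= delta -> cabs z' <= delta ->
      cabs (T z - T z') <= 1 / 2 * cabs (z - z').
    move=> zd z'd; rewrite TE cabsM cabsN cabsV ler_pdivrMr//.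
    by apply: (le_trans (almost_linear _ _ zd z'd)); lra.
  have T0 : cabs (T 0) <= delta / 4.
    by rewrite /T Q0 add0r subr0 cabsM cabsV ler_pdivrMr//; lra.
  pose x n := iter n T 0.
  have xd n : cabs (x n) <= delta / 2.
    elim: n => [|n IH]; first by rewrite /x /= cabs0; lra.
    rewrite /x /= -/(x n) -[T (x n)](subrK (T 0)).
    apply: (le_trans (cabsD _ _)).
    have := Tcontr (x n) 0; rewrite cabs0 subr0 => Tc.
    have := Tc _ (ltW delta0); have xnd : cabs (x n) <= delta by lra.
    by move/(_ xnd); lra.
  have xd1 n : cabs (x n) <= delta by have := xd n; lra.
  have dx n : cabs (x n.+1 - x n) <= delta / 4 * (1 / 2) ^+ n.
    elim: n => [|n IH]; first by rewrite subr0 expr0 mulr1.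
    apply: (le_trans (Tcontr _ _ (xd1 n.+1) (xd1 n))).
    by rewrite exprS mulrCA ler_wpM2l//; lra.
  have half01 : 0 <= (1 / 2 : R) < 1 by apply/andP; split; lra.
  have := series_cvg_geometric half01 dx; set l := limn _.
  have -> : series (fun n => x n.+1 - x n) = x.
    by apply/funext => n; rewrite /series /= telescope_sumr// subr0.
  move=> xl; have ld : cabs l <= delta / 2 by exact: cabs_limn_le xl xd.
  have ld1 : cabs l <= delta by lra.
  exists l => //; suff /eqP : T l = l.
    rewrite /T -subr_eq0 addrAC subrr add0r mulf_eq0 invr_eq0 (negbTE c0) orbF.
    by rewrite subr_eq0 eq_sym => /eqP.
  apply/eqP; rewrite -subr_eq0 -cabs_eq0 eq_le cabs_ge0 andbT.
  apply/ler_addgt0Pr => e e0; rewrite add0r.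
  have e20 : 0 < e / 2 by lra.
  move/cvgCP : (xl) => /(_ _ e20)[N _ NH].
  have h1 := NH N (leqnn N); have h2 := NH N.+1 (leqnSn N).
  rewrite -(subrK (x N.+1) (T l)) -addrA; apply: (le_trans (cabsD _ _)).
  have := Tcontr l (x N) ld1 (xd1 N); rewrite (cabs_distC l).
  rewrite -/(x N.+1) in h2 *; have := cabs_ge0 (x N - l).
  move: h1 h2; rewrite /x /= -/(x N); lra.
have [P PE] : {P : C -> C & forall w, V w -> cabs (P w) <= delta / 2 /\ Q (P w) = w}.
  apply: (@choice _ _ (fun w z => V w -> cabs z <= delta / 2 /\ Q z = w)) => w.
  have [Vw|nVw] := pselect (V w); last by exists 0.
  by have [z] := sol w Vw; exists z.
have Vr0 : 0 < cabs c * delta / 4 by rewrite divr_gt0// mulr_gt0.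
have oV : open V.
  rewrite openE => w Vw; apply/nearCP; exists (cabs c * delta / 4 - cabs w).
    by rewrite subr_gt0.
  by move=> w'; rewrite ltrBrDr -{2}(subrK w w') => /(le_lt_trans (cabsD _ _)).
exists V, P; split => //; first by rewrite /V /= cabs0.
- move=> w Vw; have [Pw Qw] := PE w Vw; split; first by apply: ltr; lra.
  have nearV : \forall w' \near w, V w' by exact: open_nbhs_nbhs.
  have /derivableP Qd1 := Qd (P w) (ltr (P w) ltac:(lra)).
  apply: ex_derive; apply: (is_derive_right_inverse _ _ _ Qd1).
  + apply/(cvgCP (F := nbhs w)) => e e0.
    have near_w : \forall w' \near w, cabs (w' - w) < cabs c / 2 * e.
      apply/nearCP; exists (cabs c / 2 * e) => //.
      by rewrite mulr_gt0// divr_gt0.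
    apply: filterS2 nearV near_w => w' /PE[Pw' Qw'].
    have := Q_expanding (P w') (P w) ltac:(lra) ltac:(lra).
    rewrite Qw Qw' => /le_lt_trans /[apply].
    by rewrite ltr_pM2l// divr_gt0.
  + by apply: filterS nearV => w' /PE[].
  (* With derivative 0, a small real increment [t] would change [Q] by at most [|c| t / 4], while
     expansion forces at least [|c| t / 2]. *)
  + apply/eqP => d0; move: Qd1; rewrite d0 => /is_deriveCP.
    have c40 : 0 < cabs c / 4 by rewrite divr_gt0.
    move=> /(_ _ c40)[r r0 rH]; pose t := Num.min (r / 2) (delta / 2).
    have t0 : 0 < t by rewrite lt_min !divr_gt0.
    have at0 : cabs (ofR t) = t by rewrite cabs_ofR gtr0_norm.
    have := rH (ofR t); rewrite at0 mulr0 subr0.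
    have tr : t < r by rewrite gt_min; apply/orP; left; lra.
    have td : t <= delta / 2 by rewrite ge_min lexx orbT.
    move=> /(_ tr); have := Q_expanding (P w + ofR t) (P w).
    rewrite [P w + _ - _]addrAC subrr add0r at0.
    have h1 : cabs (P w + ofR t) <= delta.
      by apply: (le_trans (cabsD _ _)); rewrite at0; lra.
    move=> /(_ h1 ltac:(lra)) h2 h3; have := le_trans h2 h3.
    by rewrite ler_pM2r//; lra.
(* Here [|Q z| <= 3 / 2 |c| |z|], and [3 / 16 < 1 / 4] puts [Q z] in [V]. *)
- apply/nearCP; exists (delta / 8); first by rewrite divr_gt0.
  move=> z; rewrite subr0 => zd; have zd1 : cabs z <= delta by lra.
  have Vz : V (Q z).
    rewrite /V /=; have := almost_linear z 0 zd1; rewrite cabs0 Q0 !subr0.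
    move=> /(_ (ltW delta0)) h1.
    rewrite -(subrK (c * z) (Q z)); apply: (le_lt_trans (cabsD _ _)).
    rewrite cabsM; apply: (@le_lt_trans _ _ (cabs c * (3 / 2 * cabs z))); first by lra.
    by rewrite -[ltRHS]mulrA ltr_pM2l//; have := cabs_ge0 z; lra.
  split=> //; have [Pz QP] := PE _ Vz.
  have := Q_expanding (P (Q z)) z ltac:(lra) zd1.
  rewrite QP subrr cabs0 pmulr_rle0 ?divr_gt0// => h.
  by apply/eqP; rewrite -subr_eq0 -cabs_eq0 eq_le h cabs_ge0.
Qed.

End LocalInverse.

(** * Hypergeometric coefficients and their derivatives in [epsilon] *)

Section HypergeometricCoefficients.
Variable R : realType.
Local Notation C := (Cplx R).
Implicit Types (z e d : C) (f g : C -> C) (A B : R) (U : set C) (L : C -> C).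

(* First-order expansion at [0] with explicit constants, for functions bounded
   by 1: the constants stay polynomial in the number of factors of a product. *)
Definition jet f d A B := forall e, cabs e <= 1 / 10 ->
  [/\ cabs (f e) <= 1, cabs d <= A &
      cabs (f e - f 0 - e * d) <= B * cabs e ^+ 2].

Lemma jet_leB f d A B B' : B <= B' -> jet f d A B -> jet f d A B'.
Proof.
move=> BB' fd e e10; have [f1 dA fB] := fd e e10; split => //.
by apply: (le_trans fB); rewrite ler_wpM2r// sqr_ge0.
Qed.

(** Since both functions are bounded by 1, the constants add. The extra term comes from
    [e * d * (g e - g 0)], where [|g e - g 0| <= (A' + B') |e|] because [|e|^2 <= |e|]. *)
Lemma jetM f g d d' A A' B B' : jet f d A B -> jet g d' A' B' ->
  jet (fun e => f e * g e) (d * g 0 + f 0 * d') (A + A')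
      (B + B' + A * (A' + B')).
Proof.
move=> fd gd e e10.
have [f1 dA fB] := fd e e10; have [g1 dA' gB] := gd e e10.
have [f01 _ _] := fd 0 ltac:(rewrite cabs0; lra).
have [g01 _ _] := gd 0 ltac:(rewrite cabs0; lra).
have e0 := cabs_ge0 e; have A0 : 0 <= A := le_trans (cabs_ge0 _) dA.
split.
- by rewrite cabsM mulr_ile1// cabs_ge0.
- apply: (le_trans (cabsD _ _)); rewrite !cabsM; apply: lerD.
    by rewrite -[A]mulr1 ler_pM// cabs_ge0.
  by rewrite -[A']mul1r ler_pM// cabs_ge0.
- have -> : f e * g e - f 0 * g 0 - e * (d * g 0 + f 0 * d') =
      (f e - f 0 - e * d) * g e + f 0 * (g e - g 0 - e * d')
      + e * d * (g e - g 0) by ring.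
  apply: (le_trans (cabsD _ _)); rewrite [leRHS]mulrDl; apply: lerD.
    apply: (le_trans (cabsD _ _)); rewrite [leRHS]mulrDl !cabsM; apply: lerD.
      by rewrite -[leRHS]mulr1 ler_pM ?cabs_ge0.
    by rewrite -[leRHS]mul1r ler_pM ?cabs_ge0.
  rewrite !cabsM.
  have gl : cabs (g e - g 0) <= (A' + B') * cabs e.
    rewrite -(subrK (e * d') (g e - g 0)); apply: (le_trans (cabsD _ _)).
    rewrite mulrDl [leRHS]addrC cabsM; apply: lerD; last by rewrite mulrC ler_wpM2r.
    apply: (le_trans gB).
    have B'0 : 0 <= B' * cabs e ^+ 2 := le_trans (cabs_ge0 _) gB.
    move: B'0; rewrite expr2 mulrA => B'0.
    have [->|/eqP ne0] := eqVneq (cabs e) 0; first by rewrite !mulr0.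
    have ep : 0 < cabs e by rewrite lt_def e0 andbT; apply/eqP.
    rewrite pmulr_lge0// in B'0; rewrite ler_piMr//; lra.
  apply: (@le_trans _ _ (cabs e * A * ((A' + B') * cabs e))).
    by apply: ler_pM; rewrite ?mulr_ge0 ?cabs_ge0// ler_wpM2l.
  by rewrite le_eqVlt; apply/orP; left; apply/eqP; ring.
Qed.

(** The radius [1 / 10] is half the gap between [4 / 5] and 1: the numerator is at most [9 / 10 + n]
    in modulus and the denominator at least that, so the quotient is bounded by 1. *)
Lemma jet_factor (q : R) n : 0 <= q <= 4 / 5 ->
  jet (fun e => (ofR q + e + n%:R) / (1 + e + n%:R))
      ((1 - ofR q) / (1 + n%:R) ^+ 2) 1 2.
Proof.
move=> /andP[q0 q1] e e10; have n0 : 0 <= n%:R :> R by [].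
have cu : cabs (1 + n%:R : C) = 1 + n%:R.
  by rewrite -ofR_nat -[1]/(ofR 1) -ofRD cabs_ofR ger0_norm// addr_ge0.
have u0 : (1 + n%:R : C) != 0 by rewrite -cabs_eq0 cu lt0r_neq0// ltr_wpDr.
have cue : 9 / 10 + n%:R <= cabs (1 + e + n%:R).
  have -> : 1 + e + n%:R = (1 + n%:R) - (- e) by ring.
  by apply: le_trans (cabs_sub_ge _ _); rewrite cabsN cu; lra.
have ue0 : 1 + e + n%:R != 0 by rewrite -cabs_gt0; lra.
have cq : cabs (1 - ofR q) = 1 - q.
  rewrite -[1 in LHS]/(ofR 1) -[X in cabs X](rmorphB (real_complex R)) cabs_ofR.
  by rewrite ger0_norm//; lra.
split.
- rewrite cabsM cabsV ler_pdivrMr ?cabs_gt0// mul1r.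
  have -> : ofR q + e + n%:R = ofR (q + n%:R) + e by rewrite ofRD ofR_nat; ring.
  apply: (le_trans (cabsD _ _)); rewrite cabs_ofR ger0_norm ?addr_ge0//; lra.
- rewrite cabsM cabsV cabsX cu cq ler_pdivrMr ?exprn_gt0 ?ltr_wpDr// mul1r.
  by apply: (@le_trans _ _ 1); [lra | rewrite exprn_ege1// lerDl].
- rewrite !addr0.
  have -> : (ofR q + e + n%:R) / (1 + e + n%:R) - (ofR q + n%:R) / (1 + n%:R)
      - e * ((1 - ofR q) / (1 + n%:R) ^+ 2)
    = - (1 - ofR q) / ((1 + n%:R) ^+ 2 * (1 + e + n%:R)) * e ^+ 2.
    by field; rewrite u0 ue0.
  rewrite cabsM (cabsX e) ler_wpM2r ?sqr_ge0// cabsM cabsN cabsV cabsM.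
  rewrite (cabsX (1 + n%:R)) cu cq.
  rewrite ler_pdivrMr ?mulr_gt0 ?exprn_gt0 ?cabs_gt0 ?ltr_wpDr//.
  have u1 : 1 <= (1 + n%:R) ^+ 2 :> R by rewrite exprn_ege1// lerDl.
  have : 9 / 10 <= (1 + n%:R) ^+ 2 * cabs (1 + e + n%:R).
    by rewrite -[leLHS]mul1r ler_pM//; lra.
  lra.
Qed.

Definition hratio e n : C :=
  (1 / 5 + e + n%:R) * (2 / 5 + e + n%:R) * (3 / 5 + e + n%:R)
  * (4 / 5 + e + n%:R) / (1 + e + n%:R) ^+ 4.

(** The derivative of [hratio] in [e] at 0, by the quotient rule; the quartic is
    [(N + 1/5)(N + 2/5)(N + 3/5)(N + 4/5)] expanded, the form in which it returns in the
    differential equation. *)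
Definition dhratio n : C :=
  let N := n%:R in
  (4 * N ^+ 3 + 6 * N ^+ 2 + 14 / 5 * N + 2 / 5) / (1 + N) ^+ 4
  - 4 * (N ^+ 4 + 2 * N ^+ 3 + 7 / 5 * N ^+ 2 + 2 / 5 * N + 24 / 625)
    / (1 + N) ^+ 5.

Lemma natp1_neq0 n : (1 + n%:R : C) != 0.
Proof. by rewrite addrC natr1 pnatr_eq0. Qed.

Lemma jet_hratio n : jet (hratio ^~ n) (dhratio n) 4 26.
Proof.
have q5 k : ofR (k%:R / 5) = k%:R / 5 :> C.
  by rewrite ofRM ofR_nat; congr (_ * _); rewrite /ofR fmorphV rmorph_nat.
have fac k : (k <= 4)%N -> jet (fun e => (k%:R / 5 + e + n%:R) / (1 + e + n%:R))
      ((1 - k%:R / 5) / (1 + n%:R) ^+ 2) 1 2.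
  move=> k4; rewrite -q5; apply: jet_factor.
  rewrite divr_ge0//= ler_wpM2r ?invr_ge0//.
  by rewrite ler_nat.
(* From [(1, 2)] for one factor, successive products have constants [(2, 7)], [(3, 15)],
   [(4, 26)]. *)
have := jetM (jetM (jetM (fac 1%N isT) (fac 2%N isT)) (fac 3%N isT)) (fac 4%N isT).
rewrite !addr0 /hratio /dhratio; have := natp1_neq0 n; move: (n%:R : C) => N N0.
set f := (fun e => _ * _); have -> : f = (fun e => (1 / 5 + e + N) *
    (2 / 5 + e + N) * (3 / 5 + e + N) * (4 / 5 + e + N) / (1 + e + N) ^+ 4).
  apply/funext => e; rewrite /f !exprS expr0 mulr1 !invfM; ring.
set d := (X in jet _ X _ _); set d' := (X in _ -> jet _ X _ _); have -> : d = d'.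
  by rewrite /d /d'; field.
move=> H e e10; have [H1 H2 H3] := H e e10; split => //.
  by apply: (le_trans H2); lra.
by apply: (le_trans H3); rewrite ler_wpM2r ?sqr_ge0//; lra.
Qed.

Definition hcoef e n : C :=
  poch (1 / 5 + e) n * poch (2 / 5 + e) n * poch (3 / 5 + e) n
  * poch (4 / 5 + e) n / poch (1 + e) n ^+ 4.

Lemma hcoef0 e : hcoef e 0 = 1.
Proof. by rewrite /hcoef /poch !big_ord0 expr1n invr1 !mulr1. Qed.

Lemma hcoefS e n : hcoef e n.+1 = hcoef e n * hratio e n.
Proof. by rewrite /hcoef /poch !big_ord_recr/= exprMn invfM /hratio; ring. Qed.

Fixpoint dhcoef n : C :=
  if n is m.+1 then dhcoef m * hratio 0 m + hcoef 0 m * dhratio m else 0.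

Lemma jet_coef n : jet (hcoef ^~ n) (dhcoef n) (4 * n%:R) (120 * n%:R ^+ 2).
Proof.
elim: n => [|n IH].
  move=> e e10; rewrite !hcoef0 /= cabs1 cabs0 subrr (mulr0 e) subr0 cabs0.
  by split; rewrite ?mulr0// expr0n mulr0 mul0r.
have -> : hcoef ^~ n.+1 = (fun e => hcoef e n * hratio e n).
  by apply/funext => e; exact: hcoefS.
have -> : 4 * n.+1%:R = 4 * n%:R + 4 :> R by rewrite -natr1; ring.
(* The second-order constant grows by [26 + 4 n (4 + 26)], which is below the increment
   [240 n + 120] of [120 n^2]. *)
apply: jet_leB (jetM IH (jet_hratio n)); rewrite -natr1.
by have : 0 <= n%:R :> R by []; set k := n%:R; rewrite !expr2; lra.
Qed.

Lemma unit_radius_le (a : nat -> C) (M : R) k :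
  (forall n, cabs (a n) <= M * n%:R ^+ k) -> unit_radius a.
Proof.
move=> aM.
have u1 : unit_radius (fun=> 1 : C).
  move=> r /andP[r0 r1]; exists 1 => n; rewrite cabs1 mul1r exprn_ile1//.
  exact: ltW.
move=> r r01; have /andP[r0 _] := r01.
have [B BP] := unit_radius_natX k u1 r01.
exists (`|M| * B) => n; apply: (@le_trans _ _ (M * n%:R ^+ k * r ^+ n)).
  by rewrite ler_wpM2r// exprn_ge0.
have := BP n; rewrite mulr1 cabsX cabs_nat => Bn; rewrite -mulrA.
apply: (le_trans (ler_norm _)); rewrite normrM ler_wpM2l//.
by rewrite ger0_norm// mulr_ge0// exprn_ge0.
Qed.

Lemma unit_radius_coef e : cabs e <= 1 / 10 -> unit_radius (hcoef e).
Proof.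
move=> e10; apply: (@unit_radius_le _ 1 0) => n; rewrite mul1r expr0.
by have [] := jet_coef n e10.
Qed.

Lemma unit_radius_coef0 : unit_radius (hcoef 0).
Proof. by apply: unit_radius_coef; rewrite cabs0; lra. Qed.

Lemma unit_radius_dcoef : unit_radius dhcoef.
Proof.
apply: (@unit_radius_le _ 4 1) => n; rewrite expr1.
by have [|_ + _] := jet_coef n (e := 0); [rewrite cabs0; lra|].
Qed.

Lemma is_derive_coef_sum z : cabs z < 1 ->
  is_derive (0 : C) 1 (fun e => psum (hcoef e) z) (psum dhcoef z).
Proof.
move=> z1; have z0 := cabs_ge0 z.
have ur : unit_radius (fun n => 120 * n%:R ^+ 2 : C).
  apply: (@unit_radius_le _ 120 2) => n.
  by rewrite cabsM cabsX !cabs_nat.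
have [|M [s [s01 Ms]]] := unit_radius_geometric (r := cabs z) ur.
  by rewrite z0.
apply: (is_derive_of_sq (r := 1 / 10) (M := M / (1 - s))); first lra.
move=> h /ltW h10; rewrite add0r.
pose R_ n := (hcoef h n - hcoef 0 n - h * dhcoef n) * z ^+ n.
have R_le n : cabs (R_ n) <= (M * cabs h ^+ 2) * s ^+ n.
  have [_ _ jn] := jet_coef n h10.
  rewrite cabsM cabsX mulrAC.
  have := ler_wpM2r (sqr_ge0 (cabs h)) (Ms n).
  apply: le_trans; rewrite cabsM cabsX !cabs_nat mulrAC.
  by rewrite ler_wpM2r// exprn_ge0.
have <- : limn (series R_) = psum (hcoef h) z - psum (hcoef 0) z - h * psum dhcoef z.
  apply: cvg_lim => //.
  rewrite (_ : series R_ = (fun n => series (fun n => hcoef h n * z ^+ n) n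
      - series (fun n => hcoef 0 n * z ^+ n) n
      - h * series (fun n => dhcoef n * z ^+ n) n)); last first.
    apply/funext => n; rewrite /series /= big_distrr/= -!sumrB.
    by apply: eq_bigr => i _; rewrite /R_; ring.
  apply: cvgB.
    apply: cvgB; apply: psum_cvg => //; first exact: unit_radius_coef.
    exact: unit_radius_coef0.
  by apply: cvgM; [exact: cvg_cst | exact: psum_cvg unit_radius_dcoef z1].
apply: (le_trans (cabs_series_le s01 R_le)).
by rewrite le_eqVlt; apply/orP; left; apply/eqP; ring.
Qed.

Lemma hyperFE L e z : cexp (L z) = z -> cabs z < 1 -> cabs e <= 1 / 10 ->
  hyperF L e z = cexp (e * L z) * psum (hcoef e) z.
Proof.
move=> LK z1 e10; rewrite /hyperF; apply: cvg_lim => //.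
rewrite (_ : series _ =
    (fun n => cexp (e * L z) * series (fun n => hcoef e n * z ^+ n) n)).
  apply: cvgM; first exact: cvg_cst.
  exact: psum_cvg (unit_radius_coef e10) z1.
apply/funext => n; rewrite /series /= big_distrr/=.
by apply: eq_bigr => i _; rewrite [(e + _) * L z]mulrDl cexpD cexp_natl LK mulrCA.
Qed.

Lemma psi0E U L z : log_branch U L -> U z -> cabs z < 1 ->
  psi L 0 z = psum (hcoef 0) z.
Proof.
move=> [_ _ LK] Uz z1; rewrite /psi /= invr1 mul1r hyperFE ?LK//.
  by rewrite !(mulr0, mul0r) cexp0 !mul1r.
by rewrite cabs0; lra.
Qed.

Lemma psi1E U L z : log_branch U L -> U z -> cabs z < 1 ->
  psi L 1 z = psum (hcoef 0) z * (L z - 5 * ofR (ln 5)) + psum dhcoef z.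
Proof.
move=> [_ _ LK] Uz z1; rewrite /psi derive1n1 invr1 mul1r.
apply: is_derive_derive1.
pose f e := cexp (e * (-5 * ofR (ln 5))) * (cexp (e * L z) * psum (hcoef e) z).
(* The factored form of [hyperF] holds only for [|e| <= 1 / 10], which suffices for a derivative at
   0. *)
apply: (@near_eq_is_derive _ _ _ f).
  apply/nearCP; exists (1 / 10) => [|e]; first by lra.
  rewrite subr0 => /ltW e10; rewrite hyperFE ?LK// /f.
  by congr (cexp _ * _); ring.
have dlin (c : C) : is_derive (0 : C) 1 (fun e => cexp (e * c)) c.
  have := is_deriveC_mul (is_deriveC_id 0) (is_deriveC_cst c 0).
  rewrite mul1r mulr0 addr0 => dc.
  apply: is_derive_eq (is_deriveC_comp _ dc) _.
    exact: is_derive_cexp.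
  by rewrite mul0r cexp0 mul1r.
apply: is_derive_eq (is_deriveC_mul (dlin _) (is_deriveC_mul (dlin _)
  (is_derive_coef_sum z1))) _.
by rewrite !mul0r cexp0; ring.
Qed.

End HypergeometricCoefficients.

(** * The differential equation and the Wronskian relation *)

Section Periods.
Variable R : realType.
Local Notation C := (Cplx R).
Implicit Types (z w h : C) (f g : C -> C) (a b : nat -> C).

Lemma unit_radiusD a b : unit_radius a -> unit_radius b ->
  unit_radius (fun n => a n + b n).
Proof.
move=> ua ub r r01; have /andP[r0 _] := r01.
have [A AP] := ua r r01; have [B BP] := ub r r01; exists (A + B) => n.
apply: le_trans (ler_wpM2r (exprn_ge0 _ r0) (cabsD _ _)) _.
by rewrite mulrDl lerD.
Qed.

Lemma unit_radiusZ c a : unit_radius a -> unit_radius (fun n => c * a n).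
Proof.
move=> ua r r01; have [A AP] := ua r r01; exists (cabs c * A) => n.
by rewrite cabsM -mulrA ler_wpM2l// cabs_ge0.
Qed.

Definition natX j a : nat -> C := fun n => n%:R ^+ j * a n.

(* [psum (natX j a)] is [theta^j] of the sum of the power series [a]. *)
Definition ytheta j z : C := psum (natX j (@hcoef R 0)) z.
Definition vtheta j z : C := psum (natX j (@dhcoef R)) z.

Lemma unit_radius_ycoef j : unit_radius (natX j (@hcoef R 0)).
Proof. exact: (unit_radius_natX j (@unit_radius_coef0 R)). Qed.

Lemma unit_radius_vcoef j : unit_radius (natX j (@dhcoef R)).
Proof. exact: (unit_radius_natX j (@unit_radius_dcoef R)). Qed.

Lemma is_derive_natX j a z : unit_radius a -> cabs z < 1 -> exists d,
  is_derive z 1 (psum (natX j a)) d /\ psum (natX j.+1 a) z = z * d.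
Proof.
move=> ua z1; have uj := unit_radius_natX j ua.
eexists; split; first exact: is_derive_psum.
rewrite -(is_derive_derive1 (is_derive_psum uj z1)) mul_derive_psum//.
by congr (psum _ z); apply/funext => n; rewrite /natX exprS mulrA.
Qed.

Lemma derivable_ytheta j z : cabs z < 1 -> derivable (ytheta j) z 1.
Proof. by move=> z1; case: (is_derive_psum (unit_radius_ycoef j) z1). Qed.

Lemma derivable_vtheta j z : cabs z < 1 -> derivable (vtheta j) z 1.
Proof. by move=> z1; case: (is_derive_psum (unit_radius_vcoef j) z1). Qed.

Lemma is_derive_ytheta j z : cabs z < 1 -> z != 0 ->
  is_derive z 1 (ytheta j) (ytheta j.+1 z / z).
Proof.
move=> z1 z0; have [d [yd]] := is_derive_natX j (@unit_radius_coef0 R) z1.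
by rewrite /ytheta => ->; rewrite mulrAC divff// mul1r.
Qed.

Lemma is_derive_vtheta j z : cabs z < 1 -> z != 0 ->
  is_derive z 1 (vtheta j) (vtheta j.+1 z / z).
Proof.
move=> z1 z0; have [d [yd]] := is_derive_natX j (@unit_radius_dcoef R) z1.
by rewrite /vtheta => ->; rewrite mulrAC divff// mul1r.
Qed.

Lemma ytheta_at0 j : ytheta j 0 = (j == 0%N)%:R.
Proof.
rewrite /ytheta psum0; last exact: unit_radius_ycoef.
by rewrite /natX hcoef0 mulr1 expr0n.
Qed.

Lemma vtheta_at0 j : vtheta j 0 = 0.
Proof.
rewrite /vtheta psum0; last exact: unit_radius_vcoef.
by rewrite /natX mulr0.
Qed.

Definition quartic c4 c3 c2 c1 c0 a : nat -> C := fun n =>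
  c4 * natX 4 a n + c3 * natX 3 a n + c2 * natX 2 a n + c1 * natX 1 a n
  + c0 * natX 0 a n.

Lemma unit_radius_quartic c4 c3 c2 c1 c0 a :
  unit_radius a -> unit_radius (quartic c4 c3 c2 c1 c0 a).
Proof.
move=> ua; have uZ c j := unit_radiusZ c (unit_radius_natX j ua).
exact: (unit_radiusD (unit_radiusD (unit_radiusD (unit_radiusD
  (uZ c4 4%N) (uZ c3 3%N)) (uZ c2 2%N)) (uZ c1 1%N)) (uZ c0 0%N)).
Qed.

Lemma psum_quartic c4 c3 c2 c1 c0 a z : unit_radius a -> cabs z < 1 ->
  psum (quartic c4 c3 c2 c1 c0 a) z =
  c4 * psum (natX 4 a) z + c3 * psum (natX 3 a) z + c2 * psum (natX 2 a) z
    + c1 * psum (natX 1 a) z + c0 * psum (natX 0 a) z.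
Proof.
move=> ua z1; have u j := unit_radius_natX j ua.
have uZ c j := unit_radiusZ c (u j).
have u2 := unit_radiusD (uZ c4 4%N) (uZ c3 3%N).
have u3 := unit_radiusD u2 (uZ c2 2%N).
have u4 := unit_radiusD u3 (uZ c1 1%N).
rewrite (psumD u4 (uZ c0 0%N) z1) (psumD u3 (uZ c1 1%N) z1).
rewrite (psumD u2 (uZ c2 2%N) z1) (psumD (uZ c4 4%N) (uZ c3 3%N) z1).
rewrite (psumZ c4 (u 4%N) z1) (psumZ c3 (u 3%N) z1) (psumZ c2 (u 2%N) z1).
by rewrite (psumZ c1 (u 1%N) z1) (psumZ c0 (u 0%N) z1).
Qed.

Lemma coef_recurrence n : (n.+1%:R : C) ^+ 4 * hcoef 0 n.+1 =
  (n%:R ^+ 4 + 2 * n%:R ^+ 3 + 7 / 5 * n%:R ^+ 2 + 2 / 5 * n%:R + 24 / 625)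
  * hcoef 0 n.
Proof.
have := natp1_neq0 R n; rewrite hcoefS /hratio !addr0 -natr1.
by move: (n%:R : C) => N N0; rewrite [N + 1]addrC; field.
Qed.

(** The derivative at [e = 0] of [(n + 1 + e)^4 c_(n+1)(e) = (n + 1/5 + e) ... (n + 4/5 + e)
    c_n(e)]. *)
Lemma dcoef_recurrence n :
  (n.+1%:R : C) ^+ 4 * dhcoef R n.+1 + 4 * n.+1%:R ^+ 3 * hcoef 0 n.+1 =
  (n%:R ^+ 4 + 2 * n%:R ^+ 3 + 7 / 5 * n%:R ^+ 2 + 2 / 5 * n%:R + 24 / 625)
  * dhcoef R n
  + (4 * n%:R ^+ 3 + 6 * n%:R ^+ 2 + 14 / 5 * n%:R + 2 / 5) * hcoef 0 n.
Proof.
have := natp1_neq0 R n; rewrite hcoefS /= /hratio /dhratio !addr0 -natr1.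
by move: (n%:R : C) => N N0; rewrite [N + 1]addrC; field.
Qed.

(** Multiplication by [z] is an index shift, so this is [coef_recurrence] read coefficientwise; the
    constant term is killed by [0 ^+ 4]. *)
Lemma ytheta_ode z : cabs z < 1 -> ytheta 4 z =
  z * (ytheta 4 z + 2 * ytheta 3 z + 7 / 5 * ytheta 2 z + 2 / 5 * ytheta 1 z
       + 24 / 625 * ytheta 0 z).
Proof.
move=> z1; have uc := @unit_radius_coef0 R.
rewrite {1}/ytheta (psum_shift (@unit_radius_ycoef 4) z1).
rewrite {1}/natX expr0n mul0r add0r -[ytheta 4 z in RHS]mul1r /ytheta.
rewrite -(psum_quartic _ _ _ _ _ uc z1); congr (_ * psum _ z).
by apply/funext => n; rewrite /quartic /natX coef_recurrence; ring.
Qed.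

(** This says that [ytheta 0 * L + vtheta 0] is a second solution: as [theta L = 1], applying a
    polynomial in [theta] to [ytheta 0 * L] leaves, beside the multiple of [L], its formal
    derivative applied to [ytheta 0]. *)
Lemma vtheta_ode z : cabs z < 1 -> vtheta 4 z + 4 * ytheta 3 z =
  z * (vtheta 4 z + 2 * vtheta 3 z + 7 / 5 * vtheta 2 z + 2 / 5 * vtheta 1 z
       + 24 / 625 * vtheta 0 z
       + (4 * ytheta 3 z + 6 * ytheta 2 z + 14 / 5 * ytheta 1 z
          + 2 / 5 * ytheta 0 z)).
Proof.
move=> z1; have uc := @unit_radius_coef0 R; have ud := @unit_radius_dcoef R.
have u3 := unit_radiusZ 4 (@unit_radius_ycoef 3).
have uq := unit_radius_quartic 1 2 (7 / 5) (2 / 5) (24 / 625) ud.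
have uq' := unit_radius_quartic 0 4 6 (14 / 5) (2 / 5) uc.
have vE := psum_quartic 1 2 (7 / 5) (2 / 5) (24 / 625) ud z1.
have yE := psum_quartic 0 4 6 (14 / 5) (2 / 5) uc z1.
rewrite mul1r in vE; rewrite mul0r add0r in yE.
rewrite /vtheta /ytheta -vE -yE -(psumD uq uq' z1).
rewrite -(psumZ 4 (@unit_radius_ycoef 3) z1).
rewrite -(psumD (@unit_radius_vcoef 4) u3 z1).
rewrite (psum_shift (unit_radiusD (@unit_radius_vcoef 4) u3) z1).
rewrite {1 2}/natX !expr0n !mul0r mulr0 !add0r; congr (_ * psum _ z).
apply/funext => n; rewrite /quartic; have := dcoef_recurrence n.
by rewrite /natX mulrA => ->; ring.
Qed.

(* The Wronskians [W_ij] of the two solutions [psi_0] and [psi_1], in which the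
   logarithm cancels. *)
Definition w01 z := ytheta 0 z ^+ 2 + vtheta 1 z * ytheta 0 z - vtheta 0 z * ytheta 1 z.
Definition w02 z := 2 * ytheta 1 z * ytheta 0 z + vtheta 2 z * ytheta 0 z
  - vtheta 0 z * ytheta 2 z.
Definition w03 z := 3 * ytheta 2 z * ytheta 0 z + vtheta 3 z * ytheta 0 z
  - vtheta 0 z * ytheta 3 z.
Definition w12 z := 2 * ytheta 1 z ^+ 2 + vtheta 2 z * ytheta 1 z
  - ytheta 0 z * ytheta 2 z - vtheta 1 z * ytheta 2 z.

Lemma one_sub_neq0 z : cabs z < 1 -> 1 - z != 0.
Proof.
move=> z1; rewrite subr_eq0; apply/eqP => z_eq.
by move: z1; rewrite -z_eq cabs1 ltxx.
Qed.

(* The left-hand side minus the right-hand side is the invariant alternating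
   form of the (self-dual) differential equation evaluated at the two
   solutions: its [theta] vanishes, and so does its value at [0]. *)
Lemma wronskian_relation z : cabs z < 1 ->
  (1 - z) * (w03 z - w12 z) = z * w02 z + 2 / 5 * z * w01 z.
Proof.
move=> z1.
pose A y := (1 - y) * (w03 y - w12 y) - (y * w02 y + 2 / 5 * y * w01 y).
(* The derivatives stay abstract because two versions are needed: mere existence on the whole disc,
   and the values [ytheta j.+1 w / w], [vtheta j.+1 w / w] away from 0. *)
have derA w dy dv : (forall j, is_derive w 1 (ytheta j) (dy j)) ->
    (forall j, is_derive w 1 (vtheta j) (dv j)) -> exists d, is_derive w 1 A d /\
    d = - (w03 w - w12 w)
      + (1 - w) * (3 * dy 2%N * ytheta 0 w + 3 * ytheta 2 w * dy 0%N
         + dv 3%N * ytheta 0 w + vtheta 3 w * dy 0%N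
         - dv 0%N * ytheta 3 w - vtheta 0 w * dy 3%N
         - (4 * ytheta 1 w * dy 1%N + dv 2%N * ytheta 1 w + vtheta 2 w * dy 1%N
            - dy 0%N * ytheta 2 w - ytheta 0 w * dy 2%N
            - dv 1%N * ytheta 2 w - vtheta 1 w * dy 2%N))
      - w02 w - w * (2 * dy 1%N * ytheta 0 w + 2 * ytheta 1 w * dy 0%N
         + dv 2%N * ytheta 0 w + vtheta 2 w * dy 0%N
         - dv 0%N * ytheta 2 w - vtheta 0 w * dy 2%N)
      - 2 / 5 * w01 w - 2 / 5 * w * (2 * ytheta 0 w * dy 0%N
         + dv 1%N * ytheta 0 w + vtheta 1 w * dy 0%N
         - dv 0%N * ytheta 1 w - vtheta 0 w * dy 1%N).
  move=> yd vd; eexists; split.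
    rewrite /A /w01 /w02 /w03 /w12.
    is_deriveC_tac R.
  by rewrite /w01 /w02 /w03 /w12 /= !expr1; ring.
suff Az : A z = A 0.
  apply/eqP; rewrite -subr_eq0 -/(A z) Az; apply/eqP.
  by rewrite /A /w03 /w12 !ytheta_at0 !vtheta_at0 /=; ring.
have Aex w : cabs w < 1 -> exists d, is_derive w 1 A d.
  move=> w1; have [d [Ad _]] := derA w _ _
    (fun j => derivableP (@derivable_ytheta j w w1))
    (fun j => derivableP (@derivable_vtheta j w w1)).
  by exists d.
suff Ad0 w : cabs w < 1 -> w != 0 -> is_derive w 1 A 0.
  exact: (near_constant_of_derive0 Aex Ad0 z1).
move=> w1 w0; have [d [Ad dE]] := derA w _ _
  (fun j => is_derive_ytheta j w1 w0) (fun j => is_derive_vtheta j w1 w0).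
(* As [theta W_03 = W_13 + W_04] and [theta W_12 = W_13], only [W_04] is new, and the equation gives
   [(1 - w) W_04 = w (2 W_03 + 7/5 W_02 + 2/5 W_01)]; everything then cancels. *)
suff d0 : d = 0 by rewrite d0 in Ad.
have w1n := one_sub_neq0 w1.
have y4E : ytheta 4 w = w * (2 * ytheta 3 w + 7 / 5 * ytheta 2 w
    + 2 / 5 * ytheta 1 w + 24 / 625 * ytheta 0 w) / (1 - w).
  apply: (mulIf w1n); rewrite divfK//.
  move: (ytheta_ode w1); move: (ytheta 4 w) => y4 y4E.
  by rewrite mulrBr mulr1 {1}y4E; ring.
have v4E : vtheta 4 w = (w * (2 * vtheta 3 w + 7 / 5 * vtheta 2 w
    + 2 / 5 * vtheta 1 w + 24 / 625 * vtheta 0 w + (4 * ytheta 3 w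
    + 6 * ytheta 2 w + 14 / 5 * ytheta 1 w + 2 / 5 * ytheta 0 w))
    - 4 * ytheta 3 w) / (1 - w).
  apply: (mulIf w1n); rewrite divfK//.
  move: (vtheta_ode w1); move: (vtheta 4 w) => v4 v4E.
  by rewrite mulrBr mulr1 -{1}[v4](addrK (4 * ytheta 3 w)) v4E; ring.
rewrite dE; move: y4E v4E; rewrite /w01 /w02 /w03 /w12.
move: (ytheta 0 w) (ytheta 1 w) (ytheta 2 w) (ytheta 3 w) (ytheta 4 w).
move: (vtheta 0 w) (vtheta 1 w) (vtheta 2 w) (vtheta 3 w) (vtheta 4 w).
by move=> v0 v1 v2 v3 v4 y0 y1 y2 y3 y4 -> ->; field; rewrite w0 w1n.
Qed.

End Periods.

(** * Lipschitz functions near 0 *)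

Section LipschitzNear0.
Variable R : realType.
Local Notation C := (Cplx R).
Implicit Types (z w : C) (f g : C -> C).

(** The regularity that [local_inverse] asks of the cofactor of [z]. Closure under products,
    inverses and [cexp] is enough to reach [qroot]. *)
Definition lipschitz_near0 f := exists r K : R, [/\ 0 < r, 0 <= K &
  forall z w, cabs z < r -> cabs w < r -> cabs (f z - f w) <= K * cabs (z - w)].

Lemma lipschitz_near0_continuous f (e : R) : lipschitz_near0 f -> 0 < e ->
  exists2 s : R, 0 < s & forall z, cabs z < s -> cabs (f z - f 0) < e.
Proof.
move=> [r [K [r0 K0 fK]]] e0; have K1 : 0 < K + 1 by lra.
exists (Num.min r (e / (K + 1))); first by rewrite lt_min r0 divr_gt0.
move=> z; rewrite lt_min ltr_pdivlMr// => /andP[zr ze].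
apply: le_lt_trans (fK _ _ zr _) _; first by rewrite cabs0.
by rewrite subr0; have := cabs_ge0 z; lra.
Qed.

Lemma lipschitz_near0_psum a : unit_radius a -> lipschitz_near0 (psum a).
Proof.
move=> ua; have r01 : 0 <= (1 / 2 : R) < 1 by apply/andP; split; lra.
have [M [s [s01 Ms]]] := unit_radius_geometric (unit_radius_nat ua) r01.
have /andP[_ s1] := s01.
have M0 : 0 <= M.
  by have := Ms 0%N; rewrite !expr0 !mulr1; apply: le_trans; exact: cabs_ge0.
exists (1 / 2), (2 * (M / (1 - s))); split; first lra.
  by rewrite mulr_ge0// divr_ge0// subr_ge0 ltW.
move=> z w /ltW zr /ltW wr.
(* The usual bound [n r^(n-1) |z - w|] at [r = 1 / 2], multiplied by [r] to avoid the exponent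
   [n - 1]. *)
have powB n : cabs (z ^+ n - w ^+ n) * (1 / 2)
    <= n%:R * (1 / 2) ^+ n * cabs (z - w).
  elim: n => [|n IH]; first by rewrite !expr0 subrr cabs0 !mul0r.
  have -> : z ^+ n.+1 - w ^+ n.+1 = z * (z ^+ n - w ^+ n) + (z - w) * w ^+ n.
    by rewrite !exprS; ring.
  have d0 := cabs_ge0 (z - w).
  apply: (@le_trans _ _ (1 / 2 * (n%:R * (1 / 2) ^+ n * cabs (z - w))
      + cabs (z - w) * ((1 / 2) ^+ n * (1 / 2)))).
    have h2 : 0 <= (1 / 2 : R) by lra.
    apply: le_trans (ler_wpM2r h2 (cabsD _ _)) _.
    rewrite [leLHS]mulrDl !cabsM -[X in X + _ <= _]mulrA -[X in _ + X <= _]mulrA.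
    apply: lerD.
      by apply: ler_pM; rewrite ?mulr_ge0 ?cabs_ge0.
    by rewrite ler_wpM2l// ler_wpM2r// cabsX lerXn2r ?nnegrE ?cabs_ge0.
  by rewrite -natr1 exprS le_eqVlt; apply/orP; left; apply/eqP; ring.
pose R_ n := a n * (z ^+ n - w ^+ n).
have R_le n : cabs (R_ n) <= (2 * M * cabs (z - w)) * s ^+ n.
  have h1 := ler_wpM2l (cabs_ge0 (a n)) (powB n).
  have h2 := ler_wpM2r (cabs_ge0 (z - w)) (Ms n).
  rewrite cabsM cabs_nat in h2; rewrite cabsM; lra.
have <- : limn (series R_) = psum a z - psum a w.
  apply: cvg_lim => //.
  rewrite (_ : series R_ = (fun n => series (fun n => a n * z ^+ n) n
      - series (fun n => a n * w ^+ n) n)); last first.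
    apply/funext => n; rewrite /series /= -!sumrB.
    by apply: eq_bigr => i _; rewrite /R_; ring.
  by apply: cvgB; apply: psum_cvg => //; lra.
apply: (le_trans (cabs_series_le s01 R_le)).
by rewrite le_eqVlt; apply/orP; left; apply/eqP; ring.
Qed.

Lemma lipschitz_near0_mul f g :
  lipschitz_near0 f -> lipschitz_near0 g -> lipschitz_near0 (fun z => f z * g z).
Proof.
move=> lf lg.
have [s s0 fs] := lipschitz_near0_continuous lf ltr01.
have [t t0 gt] := lipschitz_near0_continuous lg ltr01.
have [r [K [r0 K0 fK]]] := lf; have [u [B [u0 B0 gB]]] := lg.
have F0 := cabs_ge0 (f 0); have G0 := cabs_ge0 (g 0).
exists (Num.min (Num.min s t) (Num.min r u)).
exists ((cabs (f 0) + 1) * B + K * (cabs (g 0) + 1)); split.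
- by rewrite !lt_min s0 t0 r0.
- by rewrite addr_ge0// mulr_ge0//; lra.
- move=> z w; rewrite !lt_min => /andP[/andP[zs zt] /andP[zr zu]].
  move=> /andP[/andP[ws wt] /andP[wr wu]].
  have -> : f z * g z - f w * g w = f z * (g z - g w) + (f z - f w) * g w by ring.
  apply: (le_trans (cabsD _ _)); rewrite !cabsM [leRHS]mulrDl -![_ * _ * cabs _]mulrA.
  have fz : cabs (f z) <= cabs (f 0) + 1.
    by have := cabs_sub_ge (f z) (f 0); have := fs _ zs; lra.
  have gw : cabs (g w) <= cabs (g 0) + 1.
    by have := cabs_sub_ge (g w) (g 0); have := gt _ wt; lra.
  apply: lerD; first by apply: ler_pM; rewrite ?cabs_ge0// gB.
  apply: (@le_trans _ _ (K * cabs (z - w) * (cabs (g 0) + 1))).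
    by apply: ler_pM; rewrite ?cabs_ge0// fK.
  by rewrite le_eqVlt; apply/orP; left; apply/eqP; ring.
Qed.

Lemma lipschitz_near0_inv f :
  f 0 != 0 -> lipschitz_near0 f -> lipschitz_near0 (fun z => (f z)^-1).
Proof.
move=> f0 lf; have F0 : 0 < cabs (f 0) by rewrite cabs_gt0.
have F20 : 0 < cabs (f 0) / 2 by rewrite divr_gt0.
have [s s0 fs] := lipschitz_near0_continuous lf F20.
have [r [K [r0 K0 fK]]] := lf.
exists (Num.min s r), (K / (cabs (f 0) / 2) ^+ 2); split.
- by rewrite lt_min s0.
- by rewrite divr_ge0// exprn_ge0// ltW.
- have fge z : cabs z < s -> cabs (f 0) / 2 <= cabs (f z).
    move=> /fs; rewrite cabs_distC => h.
    by have := cabs_sub_ge (f 0) (f z); lra.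
  move=> z w; rewrite !lt_min => /andP[zs zr] /andP[ws wr].
  have fz := fge z zs; have fw := fge w ws.
  have fz0 : f z != 0 by rewrite -cabs_gt0 (lt_le_trans F20).
  have fw0 : f w != 0 by rewrite -cabs_gt0 (lt_le_trans F20).
  have -> : (f z)^-1 - (f w)^-1 = - (f z - f w) / (f z * f w).
    by field; rewrite fz0 fw0.
  rewrite cabsM cabsN cabsV cabsM mulrAC; apply: ler_pM.
  + exact: cabs_ge0.
  + by rewrite invr_ge0 mulr_ge0 ?cabs_ge0.
  + exact: fK.
  + rewrite lef_pV2 ?posrE ?exprn_gt0// ?mulr_gt0 ?cabs_gt0//.
    by rewrite expr2 ler_pM// ltW.
Qed.

Lemma lipschitz_near0_cexp f (c : C) :
  lipschitz_near0 f -> lipschitz_near0 (fun z => cexp (f z - c)).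
Proof.
move=> lf; have q0 : 0 < (1 / 4 : R) by lra.
(* Staying within [1 / 4] of [f 0] keeps [f z - f w] within [1 / 2], the range of the bound on
   [cexp]. *)
have [s s0 fs] := lipschitz_near0_continuous lf q0.
have [r [K [r0 K0 fK]]] := lf.
have cexp1 (h : C) : cabs h <= 1 / 2 -> cabs (cexp h - 1) <= 5 * cabs h.
  move=> h2; have := cabs_cexp_sub1_le h2; have h0 := cabs_ge0 h => h3.
  rewrite -(subrK h (cexp h - 1)); apply: (le_trans (cabsD _ _)).
  by move: h3; rewrite expr2; nra.
pose E := cabs (cexp (f 0 - c)); have E0 : 0 <= E := cabs_ge0 _.
exists (Num.min s r), (4 * E * (5 * K)); split.
- by rewrite lt_min s0.
- by rewrite !mulr_ge0.
- move=> z w; rewrite !lt_min => /andP[zs zr] /andP[ws wr].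
  have hz := fs _ zs; have hw := fs _ ws.
  have hzw : cabs (f z - f w) <= 1 / 2.
    rewrite -(subrK (f 0) (f z)) -addrA; apply: (le_trans (cabsD _ _)).
    by move: hz hw; rewrite (cabs_distC (f w)); lra.
  have cw : cabs (cexp (f w - c)) <= 4 * E.
    have -> : f w - c = (f 0 - c) + (f w - f 0) by ring.
    rewrite cexpD cabsM mulrC ler_wpM2r//.
    rewrite -(subrK 1 (cexp _)); apply: (le_trans (cabsD _ _)); rewrite cabs1.
    by have := cexp1 (f w - f 0) ltac:(lra); lra.
  have -> : cexp (f z - c) - cexp (f w - c) = cexp (f w - c) * (cexp (f z - f w) - 1).
    by rewrite mulrBr mulr1 -cexpD; congr (cexp _ - _); ring.
  rewrite cabsM -mulrA; apply: ler_pM; rewrite ?cabs_ge0//.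
  apply: (le_trans (cexp1 _ hzw)); rewrite -mulrA ler_wpM2l//.
  exact: fK.
Qed.

End LipschitzNear0.

(** * The vector field *)

Section VectorField.
Variable R : realType.
Local Notation C := (Cplx R).

(* [tpoly k] and [dtpoly k] are [t_k] and its derivative as functions of [z],
   of [x_j = x_{2j}], of the Wronskians [u = x_12 x_21 - x_11 x_22] and
   [v = x_13 x_21 - x_11 x_23], and of the derivatives [d1 .. d4, du, dv]. *)
Definition tpoly (k : nat) (z x1 x2 x3 x4 u v : C) : C :=
  match k with
  | 0%N => x1
  | 1%N => 5 ^+ 4 * x1 * ((6 * z - 1) * x1 + 5 * (11 * z - 1) * x2
           + 25 * (6 * z - 1) * x3 + 125 * (z - 1) * x4)
  | 2%N => 5 ^+ 4 * x1 ^+ 2 * ((2 * z - 7) * x1 + 15 * (z - 1) * x2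
           + 25 * (z - 1) * x3)
  | 3%N => 5 ^+ 4 * x1 ^+ 3 * ((z - 6) * x1 + 5 * (z - 1) * x2)
  | 4%N => z * x1 ^+ 5
  | 5%N => 5 ^+ 5 * (z - 1) * x1 ^+ 2 * u
  | 6%N => 5 ^+ 5 * (z - 1) * x1 * (3 * u + 5 * v)
  | _ => 0
  end.

Definition dtpoly (k : nat) (z x1 x2 x3 x4 u v d1 d2 d3 d4 du dv : C) : C :=
  match k with
  | 0%N => d1
  | 1%N => 5 ^+ 4 * (d1 * ((6 * z - 1) * x1 + 5 * (11 * z - 1) * x2
             + 25 * (6 * z - 1) * x3 + 125 * (z - 1) * x4)
           + x1 * (6 * x1 + 55 * x2 + 150 * x3 + 125 * x4
             + (6 * z - 1) * d1 + 5 * (11 * z - 1) * d2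
             + 25 * (6 * z - 1) * d3 + 125 * (z - 1) * d4))
  | 2%N => 5 ^+ 4 * (2 * x1 * d1 * ((2 * z - 7) * x1 + 15 * (z - 1) * x2
             + 25 * (z - 1) * x3)
           + x1 ^+ 2 * (2 * x1 + 15 * x2 + 25 * x3
             + (2 * z - 7) * d1 + 15 * (z - 1) * d2 + 25 * (z - 1) * d3))
  | 3%N => 5 ^+ 4 * (3 * x1 ^+ 2 * d1 * ((z - 6) * x1 + 5 * (z - 1) * x2)
           + x1 ^+ 3 * (x1 + 5 * x2 + (z - 6) * d1 + 5 * (z - 1) * d2))
  | 4%N => x1 ^+ 5 + 5 * z * x1 ^+ 4 * d1
  | 5%N => 5 ^+ 5 * (x1 ^+ 2 * u
           + (z - 1) * (2 * x1 * d1 * u + x1 ^+ 2 * du))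
  | 6%N => 5 ^+ 5 * (x1 * (3 * u + 5 * v)
           + (z - 1) * (d1 * (3 * u + 5 * v) + x1 * (3 * du + 5 * dv)))
  | _ => 0
  end.

Lemma is_derive_tpoly k (z : C) (f1 f2 f3 f4 fu fv : C -> C)
    (d1 d2 d3 d4 du dv : C) :
  is_derive z 1 f1 d1 -> is_derive z 1 f2 d2 -> is_derive z 1 f3 d3 ->
  is_derive z 1 f4 d4 -> is_derive z 1 fu du -> is_derive z 1 fv dv ->
  is_derive z 1
    (fun y => tpoly k y (f1 y) (f2 y) (f3 y) (f4 y) (fu y) (fv y))
    (dtpoly k z (f1 z) (f2 z) (f3 z) (f4 z) (fu z) (fv z) d1 d2 d3 d4 du dv).
Proof.
move=> h1 h2 h3 h4 hu hv; rewrite /tpoly /dtpoly.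
do 7?[case: k => [|k]]; (eapply is_derive_eq; first by is_deriveC_tac R);
  rewrite /= ?expr1 ?expr0; ring.
Qed.

Definition vfield (k : nat) (t0 t1 t2 t3 t4 t5 t6 : C) : C :=
  match k with
  | 0%N => 6 * 5 ^+ 4 * t0 ^+ 5 + t0 * t3 - 5 ^+ 4 * t4
  | 1%N => - (5 ^+ 8 * t0 ^+ 6) + 5 ^+ 5 * t0 ^+ 4 * t1
           + 5 ^+ 8 * t0 * t4 + t1 * t3
  | 2%N => - (3 * 5 ^+ 9 * t0 ^+ 7) - 5 ^+ 4 * t0 ^+ 5 * t1
           + 2 * 5 ^+ 5 * t0 ^+ 4 * t2 + 3 * 5 ^+ 9 * t0 ^+ 2 * t4
           + 5 ^+ 4 * t1 * t4 + 2 * t2 * t3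
  | 3%N => - (5 ^+ 10 * t0 ^+ 8) - 5 ^+ 4 * t0 ^+ 5 * t2
           + 3 * 5 ^+ 5 * t0 ^+ 4 * t3 + 5 ^+ 10 * t0 ^+ 3 * t4
           + 5 ^+ 4 * t2 * t4 + 3 * t3 ^+ 2
  | 4%N => 5 ^+ 6 * t0 ^+ 4 * t4 + 5 * t3 * t4
  | 5%N => - (5 ^+ 4 * t0 ^+ 5 * t6) + 3 * 5 ^+ 5 * t0 ^+ 4 * t5
           + 2 * t3 * t5 + 5 ^+ 4 * t4 * t6
  | 6%N => 3 * 5 ^+ 5 * t0 ^+ 4 * t6 - 5 ^+ 5 * t0 ^+ 3 * t5
           - 2 * t2 * t5 + 3 * t3 * t6
  | _ => 0
  end.

(** Here [x5] is [theta^4 x_21] solved from the equation, and [w] is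
    [theta v = 2 W_12 + (W_03 - W_12)] up to scale, its summands given by the Pluecker relation and
    by the alternating form. The factor [u / (z * x1 ^+ 2)] is the [z]-derivative of [tau0]. *)
Lemma dtpoly_vfield k (z x1 x2 x3 x4 u v : C) :
  z != 0 -> 1 - z != 0 -> x1 != 0 -> u != 0 ->
  let x5 := z * (2 * x4 + 7 / 5 * x3 + 2 / 5 * x2 + 24 / 625 * x1) / (1 - z) in
  let w := 2 * (v * x2 - u * x3) / x1 + (z * v + 2 / 5 * z * u) / (1 - z) in
  let t j := tpoly j z x1 x2 x3 x4 u v in
  dtpoly k z x1 x2 x3 x4 u v (x2 / z) (x3 / z) (x4 / z) (x5 / z) (v / z) (w / z) =
  (u / (z * x1 ^+ 2)) * ((t 5%N)^-1 *
    vfield k (t 0%N) (t 1%N) (t 2%N) (t 3%N) (t 4%N) (t 5%N) (t 6%N)).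
Proof.
move=> z0 z1 x10 u0 x5 w t; rewrite /t /x5 /w {t x5 w}.
have z1' : z - 1 != 0 by rewrite -oppr_eq0 opprB.
do 7?[case: k => [|k]]; rewrite /dtpoly /vfield /tpoly.
- by field; rewrite z0 z1' x10 u0.
- by field; rewrite z0 z1 z1' x10 u0.
- by field; rewrite z0 z1' x10 u0.
- by field; rewrite z0 z1' x10 u0.
- by field; rewrite z0 z1' x10 u0.
- by field; rewrite z0 z1' x10 u0.
- by field; rewrite z0 z1 z1' x10 u0.
- by rewrite !mulr0.
Qed.

End VectorField.

(** * Periods *)

Section PeriodValues.
Variable R : realType.
Local Notation C := (Cplx R).
Implicit Types (z w : C) (f g : C -> C) (U : set C) (L : C -> C).

Lemma twopii_neq0 : twopii R != 0.
Proof.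
rewrite mulf_neq0//; last by rewrite eq_complex /= oner_eq0 andbF.
by rewrite -cabs_eq0 cabs_ofR normr_eq0 mulf_neq0// gt_eqF// pi_gt0.
Qed.

Definition scale1 : C := twopii R ^+ 2 / 5 ^+ 4.
Definition scale2 : C := twopii R ^+ 3 / 5 ^+ 4.
Definition log5 : C := 5 * ofR (ln 5).

Lemma xx11E L z : xx L 1 1 z = scale1 * psi L 1 z.
Proof.
rewrite /xx /= mxE !big_ord_recl big_ord0 !mxE /= inordK//=.
have select3 (a b c d : C) : 0 * a + (0 * b + (1 * c + (0 * d + 0))) = c by ring.
exact: select3.
Qed.

Lemma xx21E L z : xx L 2 1 z = scale2 * psi L 0 z.
Proof.
rewrite /xx /= mxE !big_ord_recl big_ord0 !mxE /= inordK//=.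
have select4 (a b c d : C) : 0 * a + (0 * b + (0 * c + (1 * d + 0))) = d by ring.
exact: select4.
Qed.

Lemma near_log_branch_disc U L z : log_branch U L -> U z -> cabs z < 1 ->
  \forall w \near z, U w /\ cabs w < 1.
Proof.
move=> [oU _ _] Uz z1; have nU : \forall w \near z, U w by exact: open_nbhs_nbhs.
suff n1 : \forall w \near z, cabs w < 1.
  by apply: filterS2 nU n1 => w; split.
apply/nearCP; exists (1 - cabs z); first by rewrite subr_gt0.
by move=> w; rewrite ltrBrDr -{2}(subrK z w) => /(le_lt_trans (cabsD _ _)).
Qed.

(** Value and derivative go through one induction over all points: differentiating [xx L 2 k.+1] at
    [z] requires its formula on a whole neighbourhood. *)
Lemma xx2E U L k z : log_branch U L -> U z -> cabs z < 1 ->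
  xx L 2 k.+1 z = scale2 * ytheta k z /\
  is_derive z 1 (xx L 2 k.+1) (scale2 * ytheta k.+1 z / z).
Proof.
move=> UL Uz z1; elim: k z Uz z1 => [|k IH] z Uz z1.
- have E w : U w -> cabs w < 1 -> xx L 2 1 w = scale2 * ytheta 0 w.
    move=> Uw w1; rewrite xx21E (psi0E UL)//; congr (_ * psum _ w).
    by apply/funext => n; rewrite /natX expr0 mul1r.
  split; first exact: E.
  apply: near_eq_is_derive (is_derive_eq (is_deriveC_mul (is_deriveC_cst scale2 z)
    (is_derive_ytheta 0 z1 (log_branch_neq0 UL Uz))) _).
    apply: filterS (near_log_branch_disc UL Uz z1) => w [Uw w1].
    by rewrite E.
  by rewrite mul0r add0r mulrA.
- have E w : U w -> cabs w < 1 -> xx L 2 k.+2 w = scale2 * ytheta k.+1 w.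
    move=> Uw w1; have [_ wd] := IH w Uw w1.
    rewrite -[LHS]/(theta (xx L 2 k.+1) w) /theta (is_derive_derive1 wd).
    by rewrite mulrC divfK// (log_branch_neq0 UL).
  split; first exact: E.
  apply: near_eq_is_derive (is_derive_eq (is_deriveC_mul (is_deriveC_cst scale2 z)
    (is_derive_ytheta k.+1 z1 (log_branch_neq0 UL Uz))) _).
    apply: filterS (near_log_branch_disc UL Uz z1) => w [Uw w1].
    by rewrite E.
  by rewrite mul0r add0r mulrA.
Qed.

(** The Leibniz rule for [theta^k] with [theta L = 1], so that only one term differentiates the
    logarithm; at [k = 0] the coefficient [k%:R] cancels the spurious [k.-1]. *)
Definition x1theta L k z : C :=
  scale1 * (ytheta k z * (L z - log5) + k%:R * ytheta k.-1 z + vtheta k z).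

Lemma is_derive_x1theta U L k z : log_branch U L -> U z -> cabs z < 1 ->
  is_derive z 1 (x1theta L k) (x1theta L k.+1 z / z).
Proof.
move=> UL Uz z1; have z0 := log_branch_neq0 UL Uz.
have Ld := is_derive_log_branch UL Uz.
have yd := fun j => is_derive_ytheta j z1 z0.
have vd := is_derive_vtheta k z1 z0.
apply: is_derive_eq (is_deriveC_mul (is_deriveC_cst scale1 z)
  (is_deriveC_add (is_deriveC_add (is_deriveC_mul (yd k)
    (is_deriveC_sub Ld (is_deriveC_cst log5 z)))
    (is_deriveC_mul (is_deriveC_cst k%:R z) (yd k.-1))) vd)) _.
rewrite /x1theta; case: k {vd} => [|k] /=; first by field.
by rewrite -[k.+2%:R]natr1; field.
Qed.

Lemma xx1E U L k z : log_branch U L -> U z -> cabs z < 1 ->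
  xx L 1 k.+1 z = x1theta L k z /\
  is_derive z 1 (xx L 1 k.+1) (x1theta L k.+1 z / z).
Proof.
move=> UL Uz z1; elim: k z Uz z1 => [|k IH] z Uz z1.
- have E w : U w -> cabs w < 1 -> xx L 1 1 w = x1theta L 0 w.
    move=> Uw w1; rewrite xx11E (psi1E UL)// /x1theta mul0r addr0.
    congr (_ * (psum _ w * _ + psum _ w));
      by apply/funext => n; rewrite /natX expr0 mul1r.
  split; first exact: E.
  apply: near_eq_is_derive (is_derive_x1theta 0 UL Uz z1).
  by apply: filterS (near_log_branch_disc UL Uz z1) => w [Uw w1]; rewrite E.
- have E w : U w -> cabs w < 1 -> xx L 1 k.+2 w = x1theta L k.+1 w.
    move=> Uw w1; have [_ wd] := IH w Uw w1.
    rewrite -[LHS]/(theta (xx L 1 k.+1) w) /theta (is_derive_derive1 wd).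
    by rewrite mulrC divfK// (log_branch_neq0 UL).
  split; first exact: E.
  apply: near_eq_is_derive (is_derive_x1theta k.+1 UL Uz z1).
  by apply: filterS (near_log_branch_disc UL Uz z1) => w [Uw w1]; rewrite E.
Qed.

(** The branch-free expression of [t_k]: no [L] occurs, so it can define [h_k] before a branch is
    given. *)
Definition hpoly k z : C :=
  tpoly k z (scale2 * ytheta 0 z) (scale2 * ytheta 1 z) (scale2 * ytheta 2 z)
    (scale2 * ytheta 3 z) (scale1 * scale2 * w01 z) (scale1 * scale2 * w02 z).

Lemma derivable_hpoly k z : cabs z < 1 -> derivable (hpoly k) z 1.
Proof.
move=> z1; have yd j := derivableP (@derivable_ytheta R j z z1).
have vd j := derivableP (@derivable_vtheta R j z z1).
have cyd j := is_deriveC_mul (is_deriveC_cst scale2 z) (yd j).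
have [d1 w1d] : exists d, is_derive z 1 (fun y => scale1 * scale2 * w01 y) d.
  by eexists; rewrite /w01; is_deriveC_tac R.
have [d2 w2d] : exists d, is_derive z 1 (fun y => scale1 * scale2 * w02 y) d.
  by eexists; rewrite /w02; is_deriveC_tac R.
by case: (is_derive_tpoly k (cyd 0%N) (cyd 1%N) (cyd 2%N) (cyd 3%N) w1d w2d).
Qed.

(** The cofactor in [q = z * qroot z], with value [5^(-5)] at 0. *)
Definition qroot z : C := cexp (vtheta 0 z / ytheta 0 z - log5).

(** The quotient [scale1 / scale2] is [1 / (2 pi i)], so [2 pi i tau0 = psi_1 / psi_0], in which
    [L z] is a summand. *)
Lemma tau0E U L z : log_branch U L -> U z -> cabs z < 1 -> ytheta 0 z != 0 ->
  cexp (twopii R * tau0 L z) = z * qroot z.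
Proof.
move=> UL Uz z1 y0; have t0 := twopii_neq0; have [_ _ LK] := UL.
rewrite /tau0 (proj1 (xx1E 0 UL Uz z1)) (proj1 (xx2E 0 UL Uz z1)).
have -> : z * qroot z = cexp (L z + (vtheta 0 z / ytheta 0 z - log5)).
  by rewrite cexpD (LK z Uz).
congr cexp; rewrite /x1theta /scale1 /scale2 mul0r addr0.
move: (twopii R) (ytheta 0 z) (vtheta 0 z) (L z) log5 t0 y0.
by move=> t y v x l t0 y0; field; rewrite y0 t0.
Qed.

End PeriodValues.

(** * The functions [t_k] at a point of a branch, and the choice of [V] and [h] *)

Section Assembly.
Variable R : realType.
Local Notation C := (Cplx R).
Implicit Types (z w : C) (U : set C) (L : C -> C).

Definition wronskian1 L z : C :=
  xx L 1 2 z * xx L 2 1 z - xx L 1 1 z * xx L 2 2 z.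
Definition wronskian2 L z : C :=
  xx L 1 3 z * xx L 2 1 z - xx L 1 1 z * xx L 2 3 z.

Lemma tfunE L k z : tfun L k z =
  tpoly k z (xx L 2 1 z) (xx L 2 2 z) (xx L 2 3 z) (xx L 2 4 z)
    (wronskian1 L z) (wronskian2 L z).
Proof. by rewrite /tfun /tpoly /wronskian1 /wronskian2; do 7?[case: k => [|k]]. Qed.

Lemma scale1_neq0 : scale1 R != 0.
Proof. by rewrite mulf_neq0 ?invr_neq0 ?expf_neq0 ?twopii_neq0 ?pnatr_eq0. Qed.

Lemma scale2_neq0 : scale2 R != 0.
Proof. by rewrite mulf_neq0 ?invr_neq0 ?expf_neq0 ?twopii_neq0 ?pnatr_eq0. Qed.

Section AtPoint.
Variables (U : set C) (L : C -> C) (z : C).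
Hypotheses (UL : log_branch U L) (Uz : U z) (z1 : cabs z < 1).

Let z0 : z != 0 := log_branch_neq0 UL Uz.
Let x1E k : xx L 1 k.+1 z = x1theta L k z := proj1 (xx1E k UL Uz z1).
Let x2E k : xx L 2 k.+1 z = scale2 R * ytheta k z := proj1 (xx2E k UL Uz z1).

Lemma is_derive_xx1 k : is_derive z 1 (xx L 1 k.+1) (xx L 1 k.+2 z / z).
Proof. by rewrite x1E; exact: (proj2 (xx1E k UL Uz z1)). Qed.

Lemma is_derive_xx2 k : is_derive z 1 (xx L 2 k.+1) (xx L 2 k.+2 z / z).
Proof. by rewrite x2E; exact: (proj2 (xx2E k UL Uz z1)). Qed.

Lemma wronskian1E : wronskian1 L z = scale1 R * scale2 R * w01 z.
Proof. by rewrite /wronskian1 !x1E !x2E /x1theta /w01 /=; ring. Qed.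

Lemma wronskian2E : wronskian2 L z = scale1 R * scale2 R * w02 z.
Proof. by rewrite /wronskian2 !x1E !x2E /x1theta /w02 /=; ring. Qed.

Lemma tfun_hpoly k : tfun L k z = hpoly k z.
Proof. by rewrite tfunE wronskian1E wronskian2E !x2E. Qed.

Lemma xx2_ode : xx L 2 5 z = z * (2 * xx L 2 4 z + 7 / 5 * xx L 2 3 z
  + 2 / 5 * xx L 2 2 z + 24 / 625 * xx L 2 1 z) / (1 - z).
Proof.
have z1n := one_sub_neq0 z1; apply: (mulIf z1n); rewrite divfK// !x2E.
move: (ytheta_ode z1); move: (ytheta 4 z) => y4 y4E.
by rewrite mulrBr mulr1 {1}y4E; ring.
Qed.

Lemma is_derive_wronskian1 : is_derive z 1 (wronskian1 L) (wronskian2 L z / z).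
Proof.
have d1 := is_derive_xx1; have d2 := is_derive_xx2.
apply: is_derive_eq (is_deriveC_sub (is_deriveC_mul (d1 1%N) (d2 0%N))
  (is_deriveC_mul (d1 0%N) (d2 1%N))) _.
rewrite /wronskian2.
generalize (xx L 1 1 z) (xx L 1 2 z) (xx L 1 3 z) (xx L 2 1 z) (xx L 2 2 z) (xx L 2 3 z).
by move=> *; field.
Qed.

Lemma is_derive_wronskian2 : xx L 2 1 z != 0 ->
  is_derive z 1 (wronskian2 L)
    ((2 * (wronskian2 L z * xx L 2 2 z - wronskian1 L z * xx L 2 3 z) / xx L 2 1 z
     + (z * wronskian2 L z + 2 / 5 * z * wronskian1 L z) / (1 - z)) / z).
Proof.
move=> x0; have z1n := one_sub_neq0 z1.
have d1 := is_derive_xx1; have d2 := is_derive_xx2.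
apply: is_derive_eq (is_deriveC_sub (is_deriveC_mul (d1 2%N) (d2 0%N))
  (is_deriveC_mul (d1 0%N) (d2 2%N))) _.
have rel : (z * wronskian2 L z + 2 / 5 * z * wronskian1 L z) / (1 - z) =
    xx L 1 4 z * xx L 2 1 z - xx L 1 1 z * xx L 2 4 z
    - (xx L 1 3 z * xx L 2 2 z - xx L 1 2 z * xx L 2 3 z).
  apply: (mulIf z1n); rewrite divfK// wronskian1E wronskian2E !x1E !x2E.
  transitivity (scale1 R * scale2 R * (z * w02 z + 2 / 5 * z * w01 z)); first by ring.
  by rewrite -wronskian_relation// /x1theta /w03 /w12 /=; ring.
rewrite rel /wronskian1 /wronskian2.
move: x0.
generalize (xx L 1 1 z) (xx L 1 2 z) (xx L 1 3 z) (xx L 1 4 z)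
  (xx L 2 1 z) (xx L 2 2 z) (xx L 2 3 z) (xx L 2 4 z).
by move=> a1 a2 a3 a4 b1 b2 b3 b4 x0; field; rewrite z0 x0.
Qed.

Hypotheses (y0 : ytheta 0 z != 0) (w0 : w01 z != 0).

Lemma xx21_neq0 : xx L 2 1 z != 0.
Proof. by rewrite x2E; exact: (mulf_neq0 scale2_neq0 y0). Qed.

Lemma wronskian1_neq0 : wronskian1 L z != 0.
Proof.
rewrite wronskian1E.
exact: (mulf_neq0 (mulf_neq0 scale1_neq0 scale2_neq0) w0).
Qed.

Lemma is_derive_tau0 :
  is_derive z 1 (tau0 L) (wronskian1 L z / (z * xx L 2 1 z ^+ 2)).
Proof.
have x0 := xx21_neq0.
apply: is_derive_eq (is_deriveC_mul (is_derive_xx1 0)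
  (is_deriveC_inv x0 (is_derive_xx2 0))) _.
rewrite /wronskian1; move: x0.
generalize (xx L 1 1 z) (xx L 1 2 z) (xx L 2 1 z) (xx L 2 2 z).
by move=> a1 a2 b1 b2 x0; field; rewrite z0 x0.
Qed.

Lemma theta_tau0_neq0 : theta (tau0 L) z != 0.
Proof.
rewrite /theta (is_derive_derive1 is_derive_tau0).
apply: (mulf_neq0 z0 (mulf_neq0 wronskian1_neq0 _)); rewrite invr_eq0.
exact: (mulf_neq0 z0 (expf_neq0 2 xx21_neq0)).
Qed.

Lemma tfun5_neq0 : tfun L 5 z != 0.
Proof.
have zm1 : z - 1 != 0 by rewrite -oppr_eq0 opprB one_sub_neq0.
have n5 : (5 : C) ^+ 5 != 0 by rewrite expf_neq0// pnatr_eq0.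
rewrite tfunE; exact: (mulf_neq0 (mulf_neq0 (mulf_neq0 n5 zm1)
  (expf_neq0 2 xx21_neq0)) wronskian1_neq0).
Qed.

Lemma is_derive_tfun k : is_derive z 1 (tfun L k)
  (wronskian1 L z / (z * xx L 2 1 z ^+ 2) * ((tfun L 5 z)^-1 *
    vfield k (tfun L 0 z) (tfun L 1 z) (tfun L 2 z) (tfun L 3 z) (tfun L 4 z)
      (tfun L 5 z) (tfun L 6 z))).
Proof.
have x0 := xx21_neq0; have d := is_derive_xx2.
have := dtpoly_vfield k (xx L 2 2 z) (xx L 2 3 z) (xx L 2 4 z)
  (wronskian2 L z) z0 (one_sub_neq0 z1) x0 wronskian1_neq0.
cbv zeta beta; rewrite -xx2_ode -!tfunE => <-.
have -> : tfun L k = (fun y => tpoly k y (xx L 2 1 y) (xx L 2 2 y) (xx L 2 3 y)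
    (xx L 2 4 y) (wronskian1 L y) (wronskian2 L y)).
  by apply/funext => y; exact: tfunE.
exact: (is_derive_tpoly k (d 0%N) (d 1%N) (d 2%N) (d 3%N) is_derive_wronskian1
  (is_derive_wronskian2 x0)).
Qed.

Lemma dtau_tfun k : dtau L (tfun L k) z = (tfun L 5 z)^-1 *
  vfield k (tfun L 0 z) (tfun L 1 z) (tfun L 2 z) (tfun L 3 z) (tfun L 4 z)
    (tfun L 5 z) (tfun L 6 z).
Proof.
rewrite /dtau /theta (is_derive_derive1 is_derive_tau0).
rewrite (is_derive_derive1 (is_derive_tfun k)).
set e := _^-1 * _; move: xx21_neq0 wronskian1_neq0.
generalize e (xx L 2 1 z) (wronskian1 L z) => a x w x0 wr0.
by field; rewrite z0 x0 wr0.
Qed.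

End AtPoint.

Lemma qroot_lipschitz : lipschitz_near0 (@qroot R).
Proof.
apply: lipschitz_near0_cexp; apply: lipschitz_near0_mul.
  exact: (lipschitz_near0_psum (@unit_radius_vcoef R 0)).
apply: lipschitz_near0_inv; first by rewrite ytheta_at0 oner_neq0.
exact: (lipschitz_near0_psum (@unit_radius_ycoef R 0)).
Qed.

Lemma derivable_qcoord z : cabs z < 1 -> ytheta 0 z != 0 ->
  derivable (fun z => z * qroot z) z 1.
Proof.
move=> z1 y0.
have yd := derivableP (@derivable_ytheta R 0 z z1).
have vd := derivableP (@derivable_vtheta R 0 z z1).
have qd := is_deriveC_comp (is_derive_cexp _) (is_deriveC_sub (is_deriveC_mul vd
  (is_deriveC_inv y0 yd)) (is_deriveC_cst (log5 R) z)).
by case: (is_deriveC_mul (is_deriveC_id z) qd).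
Qed.

End Assembly.

Theorem theorem1 (R : realType) :
  exists (V : set (Cplx R)) (h : 'I_7 -> Cplx R -> Cplx R),
    [/\ open V, V 0, (forall k w, V w -> derivable (h k) w 1) &
     \forall z \near (0 : Cplx R)^',
       forall (U : set (Cplx R)) (L : Cplx R -> Cplx R),
       log_branch U L -> U z ->
       [/\ (* tau0 and its derivative are meaningful at z, as is 1/t5 *)
           [/\ xx L 2 1 z != 0, derivable (tau0 L) z 1,
               theta (tau0 L) z != 0, tfun L 5 z != 0 &
               forall k : 'I_7, derivable (tfun L k) z 1],
           V (cexp (twopii R * tau0 L z)),
           forall k : 'I_7,
             tfun L k z = (twopii R / 5) ^+ deg k
                        * h k (cexp (twopii R * tau0 L z)) &
           let t0 := tfun L 0 z in let t1 := tfun L 1 z in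
           let t2 := tfun L 2 z in let t3 := tfun L 3 z in
           let t4 := tfun L 4 z in let t5 := tfun L 5 z in
           let t6 := tfun L 6 z in
           dtau L (tfun L 0) z = t5^-1 *
                (6 * 5 ^+ 4 * t0 ^+ 5 + t0 * t3 - 5 ^+ 4 * t4) /\
           dtau L (tfun L 1) z = t5^-1 *
                (- (5 ^+ 8 * t0 ^+ 6) + 5 ^+ 5 * t0 ^+ 4 * t1
                 + 5 ^+ 8 * t0 * t4 + t1 * t3) /\
           dtau L (tfun L 2) z = t5^-1 *
                (- (3 * 5 ^+ 9 * t0 ^+ 7) - 5 ^+ 4 * t0 ^+ 5 * t1
                 + 2 * 5 ^+ 5 * t0 ^+ 4 * t2 + 3 * 5 ^+ 9 * t0 ^+ 2 * t4
                 + 5 ^+ 4 * t1 * t4 + 2 * t2 * t3) /\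
           dtau L (tfun L 3) z = t5^-1 *
                (- (5 ^+ 10 * t0 ^+ 8) - 5 ^+ 4 * t0 ^+ 5 * t2
                 + 3 * 5 ^+ 5 * t0 ^+ 4 * t3 + 5 ^+ 10 * t0 ^+ 3 * t4
                 + 5 ^+ 4 * t2 * t4 + 3 * t3 ^+ 2) /\
           dtau L (tfun L 4) z = t5^-1 *
                (5 ^+ 6 * t0 ^+ 4 * t4 + 5 * t3 * t4) /\
           dtau L (tfun L 5) z = t5^-1 *
                (- (5 ^+ 4 * t0 ^+ 5 * t6) + 3 * 5 ^+ 5 * t0 ^+ 4 * t5
                 + 2 * t3 * t5 + 5 ^+ 4 * t4 * t6) /\
           dtau L (tfun L 6) z = t5^-1 *
                (3 * 5 ^+ 5 * t0 ^+ 4 * t6 - 5 ^+ 5 * t0 ^+ 3 * t5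
                 - 2 * t2 * t5 + 3 * t3 * t6)]].
Proof.
have [r1 r10 y0_near] : exists2 r : R, 0 < r & forall z, cabs z < r -> ytheta 0 z != 0.
  have ly := lipschitz_near0_psum (@unit_radius_ycoef R 0).
  have [r r0 rH] := lipschitz_near0_continuous ly ltr01.
  exists r => // z /rH; rewrite -[psum _ z]/(ytheta 0 z) -[psum _ 0]/(ytheta 0 0).
  rewrite ytheta_at0 => zr; apply/eqP => yz; move: zr.
  by rewrite yz sub0r cabsN cabs1 ltxx.
have [r2 r20 w01_near] : exists2 r : R, 0 < r & forall z, cabs z < r -> w01 z != 0.
  have z1 : cabs (0 : Cplx R) < 1 by rewrite cabs0.
  have yd j := derivableP (derivable_ytheta (j := j) z1).
  have vd j := derivableP (derivable_vtheta (j := j) z1).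
  have [d wd] : exists d, is_derive (0 : Cplx R) 1 (@w01 R) d.
    by eexists; rewrite /w01; is_deriveC_tac R.
  have /cvgCP/(_ _ ltr01)/nearCP[r r0 rH] := is_derive_continuous wd.
  exists r => // z; have := rH z; rewrite subr0 => /[apply] zr.
  apply/eqP => wz; move: zr; rewrite wz sub0r cabsN /w01.
  by rewrite !ytheta_at0 !vtheta_at0 /= expr1n mulr1 addr0 mulr0 subr0 cabs1 ltxx.
have [r3 [K [r30 K0 qrootK]]] := @qroot_lipschitz R.
(* Within [rho] the power series converge, [qroot] is Lipschitz, and neither [ytheta 0] nor [w01],
   both equal to 1 at 0, vanishes. *)
pose rho := Num.min (Num.min 1 r3) (Num.min r1 r2).
have rho0 : 0 < rho by rewrite !lt_min ltr01 r10 r20 r30.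
have rhoE z : cabs z < rho -> [/\ cabs z < 1, cabs z < r3, cabs z < r1 & cabs z < r2].
  by rewrite !lt_min => /andP[/andP[? ?] /andP[? ?]].
have [V [P [oV V0 PV nearP]]] := @local_inverse R (fun z => z * qroot z)
  (@qroot R) rho K rho0 (cexp_neq0 _) (fun _ _ => erefl)
  (fun z w zr wr => let: And4 _ z3 _ _ := rhoE z zr in
     let: And4 _ w3 _ _ := rhoE w wr in qrootK z w z3 w3)
  (fun z zr => let: And4 z1 _ zr1 _ := rhoE z zr in
     derivable_qcoord z1 (y0_near z zr1)).
have t0 : twopii R / 5 != 0.
  by apply: mulf_neq0; [exact: twopii_neq0 | rewrite invr_eq0 pnatr_eq0].
(* Dividing by the nonzero constant builds the prescribed scaling into [h]; [P] recovers [z] from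
   [q]. *)
exists V, (fun k w => ((twopii R / 5) ^+ deg k)^-1 * hpoly k (P w)); split => //.
- move=> k w /PV[/rhoE[P1 _ _ _] /derivableP Pd].
  have hd := derivableP (derivable_hpoly (k := k) P1).
  by case: (is_deriveC_mul (is_deriveC_cst ((twopii R / 5) ^+ deg k)^-1 w)
    (is_deriveC_comp hd Pd)).
move/nearCP: nearP => [r r0 rH]; apply/nearCP; exists (Num.min rho r).
  by rewrite lt_min rho0.
move=> z; rewrite subr0 lt_min => /andP[/rhoE[z1 _ zr1 zr2] zr] _ U L UL Uz.
have [VQ PQ] := rH z ltac:(by rewrite subr0).
have yz := y0_near z zr1; have wz := w01_near z zr2.
have tz := tau0E UL Uz z1 yz.
have ode := dtau_tfun UL Uz z1 yz wz.
split.
- split.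
  + exact: xx21_neq0 UL Uz z1 yz.
  + by case: (is_derive_tau0 UL Uz z1 yz).
  + exact: theta_tau0_neq0 UL Uz z1 yz wz.
  + exact: tfun5_neq0 UL Uz z1 yz wz.
  + by move=> k; case: (is_derive_tfun UL Uz z1 yz wz k).
- by rewrite tz.
- move=> k; rewrite tz PQ (tfun_hpoly UL Uz z1) mulrA divff ?mul1r//.
  exact: expf_neq0.
- by do !split; [exact: (ode 0%N) | exact: (ode 1%N) | exact: (ode 2%N)
    | exact: (ode 3%N) | exact: (ode 4%N) | exact: (ode 5%N) | exact: (ode 6%N)].
Qed.
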